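(* Let $n\ge 2$ be an integer and let $A\subset \mathrm{SL}_n(\mathbb{R})$ be the group of diagonal matrices with positive diagonal entries and determinant $1$. For any $x\in\mathcal{L}_n$, the orbit closure $\overline{Ax}\subset\mathcal{L}_n$ contains a stable lattice.
   Context: $\mathcal{L}_n=\mathrm{SL}_n(\mathbb{R})/\mathrm{SL}_n(\mathbb{Z})$ is the space of unimodular (covolume one) lattices in $\mathbb{R}^n$, with the quotient topology; the coset of $g$ corresponds to the lattice $g\mathbb{Z}^n$, and $\mathrm{SL}_n(\mathbb{R})$ acts by left multiplication. For a nonzero subgroup $\Lambda\subset x$, $|\Lambda|$ denotes the covolume of $\Lambda$ in the linear subspace $\mathrm{span}(\Lambda)$ (with respect to the Euclidean structure). A lattice $x\in\mathcal{L}_n$ is called stable if $|\Lambda|\ge 1$ for every nonzero subgroup $\Lambda\subset x$. *)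

(* Defs.v *)
From HB Require Import structures.
From mathcomp Require Import all_boot all_order all_algebra.
From mathcomp Require Import all_classical all_reals all_analysis.

Set Implicit Arguments.
Unset Strict Implicit.
Unset Printing Implicit Defensive.

Import Order.TTheory GRing.Theory Num.Theory.
Import numFieldNormedType.Exports.

Local Open Scope classical_set_scope.
Local Open Scope ring_scope.
Local Open Scope quotient_scope.

Record SL (R : realType) (n : nat) : Type :=
  MkSL { SLmx : 'M[R]_n; SLmxP : \det SLmx == 1 }.

HB.instance Definition _ (R : realType) (n : nat) := [isSub for @SLmx R n].
HB.instance Definition _ (R : realType) (n : nat) := [Choice of SL R n by <:].
(* the subspace topology induced by 'M[R]_n *)
HB.instance Definition _ (R : realType) (n : nat) :=
  Topological.copy (SL R n) (initial_topology (@SLmx R n)).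

Section SpecialLinearGroup.
Context {R : realType} {n : nat}.
Implicit Types g h : SL R n.

Lemma det_SL g : \det (val g) = 1.
Proof. exact/eqP/SLmxP. Qed.

Lemma SL_unit g : val g \in unitmx.
Proof. by rewrite unitmxE det_SL unitr1. Qed.

Fact SL_one_subproof : \det (1%:M : 'M[R]_n) == 1.
Proof. by rewrite det1. Qed.

Fact SL_mul_subproof g h : \det (val g *m val h) == 1.
Proof. by rewrite det_mulmx !det_SL mulr1. Qed.

Fact SL_inv_subproof g : \det (invmx (val g)) == 1.
Proof. by rewrite det_inv det_SL invr1. Qed.

Definition SL_one : SL R n := MkSL SL_one_subproof.
Definition SL_mul g h : SL R n := MkSL (SL_mul_subproof g h).
Definition SL_inv g : SL R n := MkSL (SL_inv_subproof g).

Fact SL_mulA : associative SL_mul.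
Proof. by move=> a b c; apply/val_inj; exact: mulmxA. Qed.

Fact SL_mul1 : left_id SL_one SL_mul.
Proof. by move=> a; apply/val_inj; exact: mul1mx. Qed.

Fact SL_1mul : right_id SL_one SL_mul.
Proof. by move=> a; apply/val_inj; exact: mulmx1. Qed.

Fact SL_mulV : left_inverse SL_one SL_inv SL_mul.
Proof. by move=> a; apply/val_inj; exact/mulVmx/SL_unit. Qed.

Fact SL_Vmul : right_inverse SL_one SL_inv SL_mul.
Proof. by move=> a; apply/val_inj; exact/mulmxV/SL_unit. Qed.

HB.instance Definition _ :=
  isGroup.Build (SL R n) SL_mulA SL_mul1 SL_1mul SL_mulV SL_Vmul.

Lemma val_SLM g h : val (g * h)%g = val g *m val h. Proof. by []. Qed.
Lemma val_SL1 : val (1%g : SL R n) = 1%:M. Proof. by []. Qed.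
Lemma val_SLV g : val g^-1%g = invmx (val g). Proof. by []. Qed.

Definition SLZ : {pred SL R n} := [pred g | val g \is a mxOver Num.int].

Fact SLZ_mul_closed : mulg_closed SLZ.
Proof. by move=> g h gZ hZ; rewrite inE val_SLM mxOverM. Qed.

Fact SLZ_1 : 1%g \in SLZ.
Proof. by rewrite inE val_SL1 mxOver_scalar ?rpred0 ?rpred1. Qed.

Fact SLZ_inv_closed : invg_closed SLZ.
Proof.
move=> g gZ; rewrite inE val_SLV /invmx SL_unit det_SL invr1 scale1r.
apply/mxOverP => i j; rewrite mxE /cofactor rpredM ?rpredX ?rpredN ?rpred1//.
rewrite /determinant rpred_sum// => s _.
rewrite rpredM ?rpredX ?rpredN ?rpred1//.
by rewrite rpred_prod// => k _; rewrite !mxE; exact: (mxOverP gZ).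
Qed.

HB.instance Definition _ := isMulClosed.Build _ SLZ SLZ_mul_closed.
HB.instance Definition _ := isMul1Closed.Build _ SLZ SLZ_1.
HB.instance Definition _ := isInvClosed.Build _ SLZ SLZ_inv_closed.

(* equality of the left cosets g SL_n(Z) and h SL_n(Z) *)
Definition coset_rel : rel (SL R n) := fun g h => (g^-1 * h)%g \in SLZ.

Fact coset_rel_refl : reflexive coset_rel.
Proof. by move=> g; rewrite /coset_rel mulVg gpred1. Qed.

Fact coset_rel_sym : symmetric coset_rel.
Proof.
by move=> g h; rewrite /coset_rel -[in LHS]gpredV invgM invgK.
Qed.

Fact coset_rel_trans : transitive coset_rel.
Proof.
move=> h g k gh hk; rewrite /coset_rel.
by rewrite -[k](mulVKg h) mulgA gpredM.
Qed.

Canonical coset_equiv :=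
  EquivRel coset_rel coset_rel_refl coset_rel_sym coset_rel_trans.

End SpecialLinearGroup.

Definition lattice_space (R : realType) (n : nat) : Type :=
  quotient_topology {eq_quot (@coset_equiv R n)}.

HB.instance Definition _ (R : realType) (n : nat) :=
  Topological.on (lattice_space R n).
HB.instance Definition _ (R : realType) (n : nat) :=
  Quotient.on (lattice_space R n).

Section Lattices.
Context {R : realType} {n : nat}.
Implicit Types (g h : SL R n) (x y : lattice_space R n) (L : set 'cV[R]_n).

Lemma lattice_space_eqP g h :
  (\pi_(lattice_space R n) g = \pi_(lattice_space R n) h) <->
  (g^-1 * h)%g \in SLZ.
Proof. by split=> [/eqquotP|gh]; last exact/eqquotP. Qed.

Definition Zspan k (B : 'M[R]_(n, k)) : set 'cV[R]_n :=
  [set B *m z | z in [set z : 'cV[R]_k | z \is a mxOver Num.int]].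

Definition lattice_of x : set 'cV[R]_n := Zspan (val (repr x)).

Definition SL_act g x : lattice_space R n :=
  \pi_(lattice_space R n) (g * repr x)%g.

Lemma Zspan_mulr k (B : 'M[R]_(n, k)) (U : 'M[R]_k) :
  U \in unitmx -> U \is a mxOver Num.int -> invmx U \is a mxOver Num.int ->
  Zspan (B *m U) = Zspan B.
Proof.
move=> Uu UZ VZ; apply/seteqP; split => _ /= [z zZ <-].
  by exists (U *m z); rewrite ?mulmxA//= mxOverM.
exists (invmx U *m z); first by rewrite /= mxOverM.
by rewrite -mulmxA mulKVmx.
Qed.

Lemma repr_lattice g :
  exists2 u, u \in SLZ & repr (\pi_(lattice_space R n) g) = (g * u)%g.
Proof.
exists (g^-1 * repr (\pi_(lattice_space R n) g))%g; last by rewrite mulVKg.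
by apply/lattice_space_eqP; rewrite reprK.
Qed.

Lemma lattice_of_pi g : lattice_of (\pi_(lattice_space R n) g) = Zspan (val g).
Proof.
rewrite /lattice_of; have [u uZ ->] := repr_lattice g.
by rewrite val_SLM Zspan_mulr// ?SL_unit//; have := SLZ_inv_closed uZ.
Qed.

Lemma SL_act_pi g h :
  SL_act g (\pi_(lattice_space R n) h) = \pi_(lattice_space R n) (g * h)%g.
Proof.
rewrite /SL_act; have [u uZ ->] := repr_lattice h; apply/lattice_space_eqP.
by rewrite !invgM !mulgA mulgVK mulgVK gpredV.
Qed.

Definition diag_pos : set (SL R n) :=
  [set a | is_diag_mx (val a) /\ forall i, 0 < val a i i].

Definition diag_orbit x : set (lattice_space R n) :=
  [set SL_act a x | a in diag_pos].

Definition subgroup L : Prop := L 0 /\ forall u v, L u -> L v -> L (u - v).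

Definition Zbasis L k (B : 'M[R]_(n, k)) : Prop :=
  \rank B = k /\ L = Zspan B.

(* The k-dimensional Euclidean volume of the parallelepiped spanned by the
   columns of B is Num.sqrt (\det (B^T *m B)). It does not depend on the
   Z-basis B of L (covolE), and it is the absolute determinant of B in
   orthonormal coordinates of its column span (covol_orthonormal). The default
   value 0 is never used for a subgroup of a lattice, as it has a Z-basis. *)
Definition covol L : R :=
  xget 0 [set c | exists k (B : 'M[R]_(n, k)),
                    Zbasis L B /\ c = Num.sqrt (\det (B^T *m B))].

Definition stable x : Prop :=
  forall L, L `<=` lattice_of x -> subgroup L -> L <> [set 0] -> 1 <= covol L.

Lemma Zspan_sub k l (B : 'M[R]_(n, k)) (C : 'M[R]_(n, l)) :
  Zspan B `<=` Zspan C ->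
  exists2 U : 'M[R]_(l, k), U \is a mxOver Num.int & B = C *m U.
Proof.
move=> BC.
have H j : exists z : 'cV[R]_l, z \is a mxOver Num.int /\ C *m z = col j B.
  have [|z zZ zB] := BC (col j B); last by exists z.
  exists (delta_mx j 0); last by rewrite -colE.
  by apply/mxOverP => a b; rewrite mxE; case: (_ && _); rewrite ?rpred0 ?rpred1.
pose f j := projT1 (cid (H j)).
have fP j := projT2 (cid (H j)).
exists (\matrix_(i, j) f j i 0).
  by apply/mxOverP => i j; rewrite mxE; have [/mxOverP] := fP j.
apply/matrixP => i j; have [_ /matrixP /(_ i 0)] := fP j.
by rewrite !mxE => <-; apply: eq_bigr => l' _; rewrite !mxE.
Qed.

Lemma det_int k (U : 'M[R]_k) : U \is a mxOver Num.int -> \det U \is a Num.int.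
Proof.
move=> UZ; rewrite /determinant rpred_sum// => s _.
rewrite rpredM ?rpredX ?rpredN ?rpred1//.
by rewrite rpred_prod// => i _; exact: (mxOverP UZ).
Qed.

Lemma covolE L k (B : 'M[R]_(n, k)) :
  Zbasis L B -> covol L = Num.sqrt (\det (B^T *m B)).
Proof.
move=> [rB LB]; apply: xget_unique; first by exists k, B.
move=> _ [l [C [[rC LC] ->]]].
have [U UZ BE] : exists2 U : 'M[R]_(l, k), U \is a mxOver Num.int & B = C *m U.
  by apply: Zspan_sub; rewrite -LB LC.
have [V VZ CE] : exists2 V : 'M[R]_(k, l), V \is a mxOver Num.int & C = B *m V.
  by apply: Zspan_sub; rewrite -LC LB.
have kl : k = l.
  apply/eqP; rewrite eqn_leq; apply/andP; split.
    by rewrite -rB BE (leq_trans (mxrankM_maxl _ _))// rC.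
  by rewrite -rC CE (leq_trans (mxrankM_maxl _ _))// rB.
case: l / kl in C rC LC U UZ BE V VZ CE *.
have VU : V *m U = 1%:M.
  have fB : row_free B^T by rewrite /row_free mxrank_tr rB.
  apply/trmx_inj/(row_free_inj fB); rewrite -!trmx_mul mulmx1.
  by rewrite mulmxA -CE -BE.
have dVU : \det V * \det U = 1 by rewrite -det_mulmx VU det1.
have [V0 U0] : \det V != 0 /\ \det U != 0.
  by apply/andP; rewrite -negb_or -mulf_eq0 dVU oner_neq0.
have V1 := norm_intr_ge1 (det_int VZ) V0.
have U1 := norm_intr_ge1 (det_int UZ) U0.
have dV : `|\det V| = 1.
  apply/le_anti; rewrite V1 andbT.
  by rewrite -(normr1 R) -dVU normrM ler_peMr.
rewrite CE trmx_mul -mulmxA (mulmxA B^T) !det_mulmx det_tr mulrCA -expr2.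
by rewrite -real_normK ?num_real// dV expr1n mulr1.
Qed.

Lemma covol_orthonormal L k (Q : 'M[R]_(n, k)) (C : 'M[R]_k) :
  Q^T *m Q = 1%:M -> Zbasis L (Q *m C) -> covol L = `|\det C|.
Proof.
move=> QQ /covolE ->; rewrite trmx_mul -mulmxA (mulmxA Q^T) QQ mul1mx.
by rewrite det_mulmx det_tr -expr2 sqrtr_sqr.
Qed.

End Lattices.

(* Main.v *)
(** Among the lattices y in the closure of the orbit, choose one that is as
    close to stable as possible: th is maximal such that every sublattice of
    rank k of y has squared covolume at least th^(k(n-k)). The maximum is
    attained because, by reduction theory, lattices without short vectors have
    bounded bases. Suppose th < 1. As k(n-k) is strictly concave and the log
    covolume is submodular, the sublattices realizing the bound form a flag, as
    in the Harder-Narasimhan filtration, so they have at most n - 1 different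
    ranks in ]0, n[.
    Along exp(s t), with t in the (n-1)-dimensional Lie algebra of A, each
    squared covolume is a convex function sum_I p_I^2 exp(2 s t_I), with p_I
    the Plucker coordinates. If the n - 1 or fewer slopes at s = 0 are
    independent, all these covolumes can be made to increase. Otherwise there
    are enough t with all slopes zero that one of them is not orthogonal to the
    indicators of the pivot sets of the flag; by strict convexity some covolume
    increases and none decreases. Either way fewer ranks realize the bound, and
    after finitely many steps th can be increased, a contradiction. *)

Require Import Defs.
From mathcomp Require Import all_boot all_order all_algebra.
From mathcomp Require Import perm ring lra zify.
From mathcomp Require Import all_classical all_reals all_analysis.

Set Implicit Arguments.
Unset Strict Implicit.
Unset Printing Implicit Defensive.

Local Open Scope classical_set_scope.

Import Order.TTheory GRing.Theory Num.Theory.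
Import numFieldNormedType.Exports.
Local Open Scope ring_scope.

(** * Gram determinants as squared covolumes, and their inequalities *)

Section GramDeterminant.

(** Multilinearity in the rows: [f] chooses, for every row [i] of the product, the row [f i] of [B].
    The minors of non-injective [f] vanish. *)
Lemma det_mulmx_rowsub (R : comNzRingType) k n (A : 'M[R]_(k, n))
    (B : 'M[R]_(n, k)) :
  \det (A *m B) = \sum_(f : {ffun 'I_k -> 'I_n})
                     (\prod_i A i (f i)) * \det (rowsub f B).
Proof.
rewrite /determinant.
under eq_bigr => s _.
  under [X in _ * X]eq_bigr do rewrite mxE.
  rewrite bigA_distr_bigA big_distrr /=; over.
rewrite exchange_big; apply: eq_bigr => f _.
rewrite big_distrr; apply: eq_bigr => s _ /=.
rewrite big_split /= mulrCA; congr (_ * (_ * _)).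
by apply: eq_bigr => i _; rewrite mxE.
Qed.

Definition gram (R : comNzRingType) n k (M : 'M[R]_(n, k)) : R :=
  \det (M^T *m M).

Lemma gram_mulmx (R : comNzRingType) n k (M : 'M[R]_(n, k)) (U : 'M[R]_k) :
  gram (M *m U) = gram M * \det U ^+ 2.
Proof.
rewrite /gram trmx_mul -mulmxA (mulmxA M^T) !det_mulmx det_tr.
by rewrite mulrCA -expr2.
Qed.

Lemma gram_square (R : comNzRingType) n (M : 'M[R]_n) :
  gram M = \det M ^+ 2.
Proof. by rewrite /gram det_mulmx det_tr expr2. Qed.

(* Cauchy-Binet, with the sum over subsets of rows replaced by the sum over
   all k-tuples of rows; each subset then occurs k! times. *)
Lemma gram_diag (R : comNzRingType) n k (d : 'rV[R]_n) (M : 'M[R]_(n, k)) :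
  k`!%:R * gram (diag_mx d *m M) =
  \sum_(f : {ffun 'I_k -> 'I_n})
     (\prod_i d 0 (f i)) ^+ 2 * \det (rowsub f M) ^+ 2.
Proof.
rewrite /gram det_mulmx_rowsub -card_Sn.
rewrite -sum1_card natr_sum big_distrl /=.
under eq_bigr => s _.
  rewrite mul1r.
  (* Each of the [k!] copies of the expansion is reindexed by its own permutation [s], so that the
     sum over [s] rebuilds the Leibniz formula of a second minor. *)
  rewrite (reindex_onto (fun f : {ffun 'I_k -> 'I_n} => [ffun i => f (s i)])
            (fun f : {ffun 'I_k -> 'I_n} => [ffun i => f (s^-1%g i)])) /=;
    last first.
    by move=> f _; apply/ffunP => i; rewrite !ffunE permK.
  under eq_bigl => f.
    rewrite (_ : _ == _ = true); last first.
      by apply/eqP/ffunP => i; rewrite !ffunE permKV.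
    over.
  over.
rewrite exchange_big /=; apply: eq_bigr => f _.
rewrite (_ : \det (rowsub f M) ^+ 2 =
  \det (rowsub f M)^T * \det (rowsub f M)); last by rewrite det_tr expr2.
rewrite [\det (rowsub f M)^T]/determinant big_distrl big_distrr /=.
apply: eq_bigr => s _.
have -> : rowsub [ffun i => f (s i)] (diag_mx d *m M) =
          row_perm s (diag_mx (\row_i d 0 (f i)) *m rowsub f M).
  by apply/matrixP => i j; rewrite !mul_diag_mx !mxE !ffunE.
rewrite row_permE !det_mulmx det_perm det_diag.
have -> : \prod_i (diag_mx d *m M)^T i ([ffun i0 => f (s i0)] i) =
   (\prod_i d 0 (f i)) * \prod_i (rowsub f M)^T i (s i).
  rewrite [\prod_i d 0 _](reindex_inj (@perm_inj _ s)) -big_split.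
  apply: eq_bigr => i _ /=.
  by rewrite mul_diag_mx !mxE !ffunE.
have -> : \prod_i (\row_j d 0 (f j)) 0 i = \prod_i d 0 (f i).
  by apply: eq_bigr => i _; rewrite mxE.
by move: (\prod_i _) (\prod_i _) (\det _) ((-1) ^+ s) => w x y z; ring.
Qed.

Lemma gramE (R : comNzRingType) n k (M : 'M[R]_(n, k)) :
  k`!%:R * gram M = \sum_(f : {ffun 'I_k -> 'I_n}) \det (rowsub f M) ^+ 2.
Proof.
rewrite -{1}[M]mul1mx -diag_const_mx gram_diag; apply: eq_bigr => f _.
by under eq_bigr do rewrite mxE; rewrite prodr_const expr1n expr1n mul1r.
Qed.

Lemma gram_ge0 (R : realDomainType) n k (M : 'M[R]_(n, k)) : 0 <= gram M.
Proof.
rewrite -(@pmulr_rge0 _ k`!%:R) ?ltr0n ?fact_gt0// gramE.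
by apply: sumr_ge0 => f _; exact: sqr_ge0.
Qed.

Lemma gram_gt0P (R : realFieldType) n k (M : 'M[R]_(n, k)) :
  (0 < gram M) = (\rank M == k).
Proof.
apply/idP/eqP => [gM|rM].
  apply/eqP; rewrite eqn_leq rank_leq_col /=.
  have rk : \rank (M^T *m M) = k.
    by apply: mxrank_unit; rewrite unitmxE unitfE gt_eqF.
  by rewrite -[leqLHS]rk mxrankM_maxr.
have fM : row_full M by rewrite /row_full rM.
rewrite -(@pmulr_rgt0 _ k`!%:R) ?ltr0n ?fact_gt0// gramE.
have fu := fullrowsub_unit fM.
rewrite (bigD1 (fullrankfun fM))//= ltr_pwDl//.
  rewrite exprn_even_gt0//= -unitfE -unitmxE; exact: fu.
by apply: sumr_ge0 => f _; exact: sqr_ge0.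
Qed.

Lemma gram_row_mx_orth (R : comNzRingType) n k l (A : 'M[R]_(n, k))
    (B : 'M[R]_(n, l)) :
  A^T *m B = 0 -> gram (row_mx A B) = gram A * gram B.
Proof.
by move=> AB; rewrite /gram tr_row_mx mul_col_row AB det_lblock.
Qed.

Lemma gram_row_mxC (R : comNzRingType) n k l (A : 'M[R]_(n, k))
    (B : 'M[R]_(n, l)) (X : 'M[R]_(k, l)) :
  gram (row_mx A (B + A *m X)) = gram (row_mx A B).
Proof.
have -> : row_mx A (B + A *m X) = row_mx A B *m block_mx 1%:M X 0 1%:M.
  by rewrite mul_row_block !mulmx1 mulmx0 addr0 addrC.
by rewrite gram_mulmx det_ublock !det1 mulr1 expr1n mulr1.
Qed.

(** Weight 1 on the rows of [A] and 0 on those of [B] turns the stacked matrix into [A] padded with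
    zeros, and weights in [0, 1] only shrink the Cauchy-Binet terms. *)
Lemma gram_col_mx_ge (R : realDomainType) n m k (A : 'M[R]_(n, k))
    (B : 'M[R]_(m, k)) :
  gram A <= gram (col_mx A B).
Proof.
have -> : gram A = gram (diag_mx (row_mx (const_mx 1) (const_mx 0)) *m
                         col_mx A B).
  rewrite diag_mx_row mul_block_col !mul0mx addr0 add0r !diag_const_mx.
  by rewrite mul1mx raddf0 mul0mx /gram tr_col_mx mul_row_col mulmx0 addr0.
rewrite -(@ler_pM2l _ k`!%:R) ?ltr0n ?fact_gt0// gram_diag gramE.
apply: ler_sum => f _; rewrite ler_piMl ?sqr_ge0// expr_le1// ?prodr_ge0 //.
- rewrite -[leRHS](expr1n _ #|'I_k|) -prodr_const.
  apply: ler_prod => i _.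
  by rewrite mxE; case: splitP => j _; rewrite mxE ?ler01 ?lexx.
- by move=> i _; rewrite mxE; case: splitP => j _; rewrite mxE.
Qed.

(** By orthogonality, [A + B] and [col_mx A B] have the same Gram matrix. *)
Lemma gram_addr_orth_ge (R : realDomainType) n k (A B : 'M[R]_(n, k)) :
  A^T *m B = 0 -> gram A <= gram (A + B).
Proof.
move=> AB; rewrite (_ : gram (A + B) = gram (col_mx A B)); last first.
  rewrite /gram tr_col_mx mul_row_col [(A + B)^T]raddfD mulmxDl !mulmxDr AB.
  have -> : B^T *m A = 0 by apply: trmx_inj; rewrite trmx_mul trmxK AB trmx0.
  by rewrite addr0 add0r.
exact: gram_col_mx_ge.
Qed.

Lemma orth_proj (R : realFieldType) n k l (A : 'M[R]_(n, k))
    (B : 'M[R]_(n, l)) : 0 < gram A ->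
  exists X, A^T *m (B + A *m X) = 0.
Proof.
move=> gA; have uA : A^T *m A \in unitmx by rewrite unitmxE unitfE gt_eqF.
(* Minus the coefficients of the orthogonal projection of [B] onto the column span of [A]. *)
exists (- (invmx (A^T *m A) *m (A^T *m B))).
by rewrite mulmxN mulmxBr !mulmxA mulmxV// mul1mx subrr.
Qed.

(** Removing from [B] its projection onto the span of [A] keeps the volume of [row_mx A B] and does
    not increase that of [B]. *)
Lemma gram_row_mx_le (R : realFieldType) n k l (A : 'M[R]_(n, k))
    (B : 'M[R]_(n, l)) : 0 < gram A ->
  gram (row_mx A B) <= gram A * gram B.
Proof.
move=> gA; have [X AX] := orth_proj B gA.
rewrite -(gram_row_mxC _ _ X) gram_row_mx_orth//.
rewrite ler_pM2l//.
have {2}-> : B = (B + A *m X) + A *m (- X) by rewrite mulmxN addrK.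
apply: gram_addr_orth_ge; rewrite mulmxA.
suff -> : (B + A *m X)^T *m A = 0 by rewrite mul0mx.
by apply: trmx_inj; rewrite trmx_mul trmxK AX trmx0.
Qed.

(* Fischer's inequality: log covolume is submodular. *)
Lemma gram_submodular (R : realFieldType) n k l m (A : 'M[R]_(n, k))
    (B : 'M[R]_(n, l)) (C : 'M[R]_(n, m)) :
  0 < gram A -> 0 < gram (row_mx A B) ->
  gram (row_mx A (row_mx B C)) * gram A <=
  gram (row_mx A B) * gram (row_mx A C).
Proof.
move=> gA; have [X AX] := orth_proj B gA; have [Y AY] := orth_proj C gA.
(* Modulo the span of [A], the claim becomes [gram_row_mx_le] for the parts of [B] and [C]
   orthogonal to [A]. *)
rewrite -(gram_row_mxC A B X) -(gram_row_mxC A C Y).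
rewrite -(gram_row_mxC A (row_mx B C) (row_mx X Y)) mul_mx_row add_row_mx.
move: AX AY; set B' := B + _; set C' := C + _ => AB AC.
have ABC : A^T *m row_mx B' C' = 0 by rewrite mul_mx_row AB AC row_mx0.
rewrite (gram_row_mx_orth AB) (gram_row_mx_orth AC) (gram_row_mx_orth ABC).
rewrite pmulr_rgt0// => gB.
rewrite mulrAC [leRHS]mulrACA ler_pM2l ?mulr_gt0//.
exact: gram_row_mx_le gB.
Qed.

End GramDeterminant.

(** * Distortion and discreteness of covolumes *)

Section GramBounds.

Lemma det_rowsub_mulmx (R : comNzRingType) m n k (h : 'M[R]_(m, n))
    (M : 'M[R]_(n, k)) (f : 'I_k -> 'I_m) :
  \det (rowsub f (h *m M)) =
  \sum_(e : {ffun 'I_k -> 'I_n}) (\prod_i h (f i) (e i)) * \det (rowsub e M).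
Proof.
have -> : rowsub f (h *m M) = rowsub f h *m M.
  by apply/matrixP => i j; rewrite !mxE; apply: eq_bigr => l _; rewrite mxE.
rewrite det_mulmx_rowsub; apply: eq_bigr => e _; congr (_ * _).
by apply: eq_bigr => i _; rewrite mxE.
Qed.

Lemma sqr_det_rowsub_le (R : realDomainType) n k (M : 'M[R]_(n, k))
    (f : {ffun 'I_k -> 'I_n}) :
  \det (rowsub f M) ^+ 2 <= k`!%:R * gram M.
Proof.
by rewrite gramE (bigD1 f)//= lerDl sumr_ge0// => g _; exact: sqr_ge0.
Qed.

(** The minors of [h *m M] are fixed linear combinations of those of [M], each of which is at most
    the square root of [k! gram M] in absolute value. *)
Lemma gram_mulmx_le (R : rcfType) m n (h : 'M[R]_(m, n)) k :
  exists2 c, 0 < c & forall M : 'M[R]_(n, k), gram (h *m M) <= c * gram M.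
Proof.
pose X (f : {ffun 'I_k -> 'I_m}) :=
  \sum_(e : {ffun 'I_k -> 'I_n}) `|\prod_i h (f i) (e i)|.
exists (1 + \sum_f X f ^+ 2).
  by rewrite ltr_pwDl// sumr_ge0// => f _; exact: sqr_ge0.
move=> M; have k0 : 0 < k`!%:R :> R by rewrite ltr0n fact_gt0.
have gM : 0 <= k`!%:R * gram M by rewrite mulr_ge0 ?gram_ge0// ltW.
rewrite -(ler_pM2l k0) mulrCA gramE mulrDl mul1r big_distrl /=.
rewrite ler_wpDl//; apply: ler_sum => f _.
rewrite det_rowsub_mulmx.
rewrite -[leRHS](_ : (X f * Num.sqrt (k`!%:R * gram M)) ^+ 2 = _).
  rewrite -[leLHS]real_normK ?num_real// ler_sqr ?nnegrE ?mulr_ge0 ?sqrtr_ge0//.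
    rewrite (le_trans (ler_norm_sum _ _ _))// big_distrl /= ler_sum// => e _.
    rewrite normrM ler_wpM2l// -sqrtr_sqr ler_wsqrtr//.
    exact: sqr_det_rowsub_le.
  by apply: sumr_ge0 => e _.
by rewrite exprMn sqr_sqrtr.
Qed.

Lemma finite_gap (R : realDomainType) (T : finType) (F : T -> R) v :
  exists2 d, 0 < d & forall q, v < F q -> v + d <= F q.
Proof.
suff [d d0 H] : exists2 d, 0 < d &
    forall q, q \in enum T -> v < F q -> v + d <= F q.
  by exists d => // q; apply: H; rewrite mem_enum.
elim: (enum T) => [|q s [d d0 IH]]; first by exists 1.
have [vq|qv] := ltP v (F q); last first.
  exists d => // p; rewrite inE => /predU1P[->|/IH//].
  by rewrite ltNge qv.
exists (Num.min d (F q - v)); first by rewrite lt_min d0 subr_gt0.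
move=> p; rewrite inE => /predU1P[-> _|ps vp].
  by rewrite -lerBrDl ge_min lexx orbT.
by rewrite (le_trans _ (IH p ps vp))// lerD2l ge_min lexx.
Qed.

(* The covolume depends only on the Plucker vector, which is integral and
   bounded once the covolume is; hence covolumes form a discrete set. *)
Lemma gram_gap (R : realType) n (g : 'M[R]_n) k v : g \in unitmx ->
  exists2 d, 0 < d & forall Z : 'M[R]_(n, k), Z \is a mxOver Num.int ->
    v < gram (g *m Z) -> v + d <= gram (g *m Z).
Proof.
move=> gu; have [c c0 Hc] := gram_mulmx_le (invmx g) k.
have k0 : 0 < k`!%:R :> R by rewrite ltr0n fact_gt0.
(* If [gram (g *m Z) < v + 1], going back by [invmx g] bounds [k! gram Z], hence every squared minor
   of [Z], by [N.+1]. *)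
pose N := Num.Def.truncn (k`!%:R * (c * (`|v| + 1))).
have HN : k`!%:R * (c * (`|v| + 1)) < N.+1%:R.
  by rewrite truncnS_gt.
(* Candidate Plucker vectors: integral entries of absolute value at most [N.+1], shifted into an
   ordinal. [F] is the Gram determinant that Cauchy-Binet assigns to such a vector. *)
pose T := {ffun {ffun 'I_k -> 'I_n} -> 'I_(N.+1 + N.+1).+1}.
pose F (q : T) : R := k`!%:R^-1 * \sum_(f : {ffun 'I_k -> 'I_n})
  (\sum_(e : {ffun 'I_k -> 'I_n})
     (\prod_i g (f i) (e i)) * ((q e : nat)%:R - N.+1%:R)) ^+ 2.
have [d d0 Hd] := finite_gap F v.
exists (Num.min d 1); first by rewrite lt_min d0 ltr01.
move=> Z ZZ vZ; have [gZ|gZ] := leP (v + 1) (gram (g *m Z)).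
  by rewrite (le_trans _ gZ)// lerD2l ge_min lexx orbT.
have gZN : k`!%:R * gram Z < N.+1%:R.
  rewrite (le_lt_trans _ HN)// ler_pM2l//.
  rewrite -[Z in gram Z](mulKmx gu) (le_trans (Hc _))// ler_pM2l//.
  by rewrite (le_trans (ltW gZ))// lerD2r ler_norm.
have detN (e : {ffun 'I_k -> 'I_n}) :
    exists q : 'I_(N.+1 + N.+1).+1,
      (q : nat)%:R - N.+1%:R = \det (rowsub e Z).
  have dZ : \det (rowsub e Z) \is a Num.int.
    by apply: det_int; apply/mxOverP => i j; rewrite mxE; exact: (mxOverP ZZ).
  have dN : `|\det (rowsub e Z)| < N.+1%:R.
    rewrite (le_lt_trans _ gZN)// (le_trans _ (sqr_det_rowsub_le Z e))//.
    (* The minor is an integer, so its absolute value is at most its square. *)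
    rewrite -[leRHS]real_normK ?num_real//.
    rewrite intr_ler_sqr// intr_nat// natr_norm_int//.
  have : \det (rowsub e Z) + N.+1%:R \is a Num.nat.
    rewrite natrEint rpredD ?natr_int//=.
    by move: dN; rewrite ltr_norml => /andP[]; lra.
  move=> /natrP[q qE].
  have qN : (q < (N.+1 + N.+1).+1)%N.
    rewrite ltnS -(ler_nat R) -qE natrD lerD2r.
    by rewrite (le_trans (ler_norm _))// ltW.
  by exists (Ordinal qN); rewrite /= -qE addrK.
have [q Hq] := fin_all_exists detN.
have FZ : F (finfun q) = gram (g *m Z).
  apply: (canLR (mulKf (lt0r_neq0 k0))); rewrite gramE.
  apply: eq_bigr => f _; rewrite det_rowsub_mulmx; congr (_ ^+ 2).
  by apply: eq_bigr => e _; rewrite ffunE Hq.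
by rewrite -FZ (le_trans _ (Hd _ _)) ?FZ// lerD2l ge_min lexx.
Qed.

Lemma gram_int_ge1 (R : realType) n k (Z : 'M[R]_(n, k)) :
  Z \is a mxOver Num.int -> \rank Z = k -> 1 <= gram Z.
Proof.
move=> ZZ rZ; rewrite -(ger0_norm (gram_ge0 Z)) norm_intr_ge1//.
  by apply: det_int; rewrite mxOverM//;
     apply/mxOverP => i j; rewrite mxE (mxOverP ZZ).
by rewrite gt_eqF// gram_gt0P rZ.
Qed.

End GramBounds.

(** * Subgroups and the extension of integral bases *)

Section IntegerBases.
Context {R : realType}.

Lemma mxrank_colP n k (B : 'M[R]_(n, k)) :
  (forall u : 'cV_k, B *m u = 0 -> u = 0) <-> \rank B = k.
Proof.
split=> [H|rB u Bu].
  rewrite -mxrank_tr; apply/eqP; rewrite -/(row_free _) -kermx_eq0.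
  apply/eqP/row_matrixP => i; rewrite row0; apply: trmx_inj; rewrite trmx0.
  apply: H; apply: trmx_inj; rewrite trmx_mul trmxK trmx0.
  by rewrite -row_mul mulmx_ker row0.
have fB : row_free B^T by rewrite /row_free mxrank_tr rB.
apply/trmx_inj/(row_free_inj fB).
by rewrite -trmx_mul Bu !trmx0 mul0mx.
Qed.

Lemma subgroupN n (L : set 'cV[R]_n) u : subgroup L -> L u -> L (- u).
Proof. by move=> [L0 LB] Lu; rewrite -sub0r; exact: LB. Qed.

Lemma subgroupD n (L : set 'cV[R]_n) u v :
  subgroup L -> L u -> L v -> L (u + v).
Proof.
by move=> sL Lu Lv; rewrite -[v]opprK; apply: sL.2 => //; exact: subgroupN.
Qed.

Lemma subgroupZ n (L : set 'cV[R]_n) (a : R) u :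
  subgroup L -> a \is a Num.int -> L u -> L (a *: u).
Proof.
move=> sL /intrP[m ->] Lu.
suff H j : L (j%:R *: u).
  by case: m => j; rewrite ?NegzE ?rmorphN ?scaleNr; [|apply: subgroupN => //];
    exact: H.
elim: j => [|j IH]; first by rewrite scale0r; exact: sL.1.
by rewrite mulrS scalerDl scale1r; exact: subgroupD.
Qed.

Lemma subgroup_mulmx n (L : set 'cV[R]_n) k (B : 'M[R]_(n, k)) (z : 'cV[R]_k) :
  subgroup L -> (forall j, L (col j B)) -> z \is a mxOver Num.int ->
  L (B *m z).
Proof.
move=> sL LB zZ.
have -> : B *m z = \sum_j z j 0 *: col j B.
  apply/matrixP => i j; rewrite mxE summxE; apply: eq_bigr => l _.
  by rewrite !mxE mulrC ord1.
apply: big_ind => //; first exact: sL.1.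
  by move=> u v; exact: subgroupD.
by move=> j _; apply: subgroupZ => //; exact: (mxOverP zZ).
Qed.

Lemma Zspan_col n k (B : 'M[R]_(n, k)) j : Zspan B (col j B).
Proof.
exists (delta_mx j 0); last by rewrite -colE.
by apply/mxOverP => a b; rewrite mxE; case: (_ && _); rewrite ?rpred0 ?rpred1.
Qed.

(** Lifting the basis [D] of the image splits [L] as the kernel of [K] on [L] plus the span of the
    lifts. *)
Lemma Zbasis_extend n m (K : 'M[R]_(m, n)) (L : set 'cV[R]_n) a c
    (A : 'M[R]_(n, a)) (D : 'M[R]_(m, c)) :
  subgroup L -> Zbasis [set v | L v /\ K *m v = 0] A ->
  Zbasis [set K *m v | v in L] D ->
  exists2 C : 'M[R]_(n, c), K *m C = D & Zbasis L (row_mx A C).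
Proof.
move=> sL [rA LA] [rD LD].
have /choice[f Hf] (j : 'I_c) : exists v, L v /\ K *m v = col j D.
  have : Zspan D (col j D) by exact: Zspan_col.
  by rewrite -LD => -[v Lv Kv]; exists v.
pose C := \matrix_(i, j) f j i 0.
have colC j : col j C = f j by apply/colP => i; rewrite !mxE.
have KC : K *m C = D.
  apply/matrixP => i j; have /matrixP/(_ i 0) := (Hf j).2.
  rewrite !mxE => <-; apply: eq_bigr => l _; by rewrite mxE.
have KA : K *m A = 0.
  apply/matrixP => i j; have : Zspan A (col j A) by exact: Zspan_col.
  rewrite -LA => -[_ /matrixP /(_ i 0)]; rewrite !mxE => KA0; rewrite -[RHS]KA0.
  by apply: eq_bigr => l _; rewrite mxE.
exists C => //; split.
  apply/mxrank_colP => u; rewrite -[u]vsubmxK mul_row_col => H.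
  have u2 : dsubmx u = 0.
    apply: (mxrank_colP D).2 => //.
    have := congr1 (mulmx K) H.
    by rewrite mulmxDr !mulmxA KA KC mul0mx add0r mulmx0.
  move: H; rewrite u2 mulmx0 addr0 => H.
  by rewrite ((mxrank_colP A).2 rA _ H) col_mx0.
apply/seteqP; split=> v.
  move=> Lv; have : [set K *m v | v in L] (K *m v) by exists v.
  rewrite LD => -[z zZ Dz].
  have : [set v | L v /\ K *m v = 0] (v - C *m z).
    split; last by rewrite mulmxBr mulmxA KC Dz subrr.
    apply: sL.2 => //; apply: subgroup_mulmx => // j; rewrite colC.
    exact: (Hf j).1.
  rewrite LA => -[w wZ Aw]; exists (col_mx w z).
    apply/mxOverP => i j; rewrite mxE.
    by case: splitP => l _; [exact: (mxOverP wZ)|exact: (mxOverP zZ)].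
  by rewrite mul_row_col Aw subrK.
move=> [z zZ <-]; apply: subgroup_mulmx => // j.
rewrite -[j]fintype.splitK; case: (fintype.split j) => i /=.
  rewrite colKl.
  have : Zspan A (col i A) by exact: Zspan_col.
  by rewrite -LA => -[].
rewrite colKr colC; exact: (Hf i).1.
Qed.

End IntegerBases.

(** * Existence of integral bases, saturations and adapted bases *)

Section Sublattices.
Context {R : realType}.

Lemma mxOver_intB m n (A B : 'M[R]_(m, n)) : A \is a mxOver Num.int ->
  B \is a mxOver Num.int -> A - B \is a mxOver Num.int.
Proof.
move=> AZ BZ; apply/mxOverP => i j.
by rewrite !mxE rpredB ?(mxOverP AZ)// (mxOverP BZ).
Qed.

(** By Euclidean division, the least positive element generates. The zero subgroup gets the empty
    basis. *)
Lemma ex_Zbasis_cV1 (L : set 'cV[R]_1) :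
  subgroup L -> (forall v, L v -> v \is a mxOver Num.int) ->
  exists k (B : 'M[R]_(1, k)), Zbasis L B.
Proof.
move=> sL LZ.
pose P m := `[< (0 < m)%N /\ L (const_mx m%:R) >].
have [exP|nP] := pselect (exists m, P m); last first.
  exists 0%N, 0; split; first exact: mxrank0.
  apply/seteqP; split=> v.
    move=> Lv; exists 0; first by rewrite /= mxOver0 ?rpred0.
    rewrite mul0mx; apply/esym/eqP/negP => v0; apply: nP.
    have := mxOverP (LZ v Lv) 0 0;
    move=> vZ; have /natrP[m mE] := natr_norm_int vZ.
    have v00 : v 0 0 != 0.
      apply: contra_notN v0 => /eqP v00; apply/eqP/colP => i.
      by rewrite ord1 v00 mxE.
    exists m; apply/asboolP; split.
      by rewrite lt0n -(@eqr_nat R) -mE normr_eq0.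
    have -> : const_mx m%:R = Num.sg (v 0 0) *: v.
      by apply/matrixP => i j; rewrite !mxE !ord1 -mE normrEsg.
    apply: subgroupZ => //; rewrite /Num.sg.
    by case: ifP; rewrite ?rpred0//; case: ifP; rewrite ?rpredN rpred1.
  by move=> [z _ <-]; rewrite mul0mx; exact: sL.1.
have [d /asboolP[d0 Ld] dmin] := ex_minnP exP.
exists 1%N, (const_mx d%:R); split.
  apply/mxrank_colP => u /matrixP/(_ 0 0); rewrite !mxE big_ord1 !mxE.
  move/eqP; rewrite mulf_eq0 pnatr_eq0 -leqn0 leqNgt d0 /= => /eqP u0.
  by apply/colP => i; rewrite ord1 u0 mxE.
apply/seteqP; split=> v.
  move=> Lv; have /intrP[z zE] := mxOverP (LZ v Lv) 0 0.
  have dz : (z = (z %/ d)%Z * d + (z %% d)%Z)%R by exact: divz_eq.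
  have : ((z %% d)%Z < d)%R by rewrite ltz_pmod// ltz_nat.
  have : (0 <= (z %% d)%Z)%R by rewrite modz_ge0// eqz_nat -lt0n.
  move: dz; case: (z %% d)%Z => // r dz _; rewrite ltz_nat => rd.
  have {}dz : z%:~R = (z %/ d)%Z%:~R * d%:R + r%:R :> R.
    by rewrite {1}dz intrD intrM.
  have r0 : r = 0%N.
    apply/eqP; rewrite -leqn0 leqNgt; apply/negP => r0.
    suff /dmin : P r by rewrite leqNgt rd.
    apply/asboolP; split=> //.
    have -> : const_mx r%:R = v - (z %/ d)%Z%:~R *: const_mx d%:R.
      apply/matrixP => i j; rewrite !mxE !ord1 zE dz.
      by rewrite addrAC subrr add0r.
    apply: sL.2 => //; apply: subgroupZ => //; exact: intr_int.
  exists (const_mx (z %/ d)%Z%:~R).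
    by apply/mxOverP => i j; rewrite mxE intr_int.
  apply/matrixP => i j; rewrite !mxE big_ord1 !mxE !ord1 zE dz r0.
  by rewrite addr0 mulrC.
move=> [z zZ <-]; apply: subgroup_mulmx => // j.
by rewrite (_ : col j _ = const_mx d%:R)//; apply/matrixP => a b; rewrite !mxE.
Qed.

(** Induction on the dimension: the first coordinate maps [L] onto a subgroup of the integers, and
    its kernel lives in one dimension less. *)
Lemma ex_Zbasis n (L : set 'cV[R]_n) :
  subgroup L -> (forall v, L v -> v \is a mxOver Num.int) ->
  exists k (B : 'M[R]_(n, k)), Zbasis L B.
Proof.
elim: n L => [|n IH] L sL LZ.
  exists 0%N, 0; split; first exact: mxrank0.
  apply/seteqP; split=> v _.
    by exists 0; [rewrite /= mxOver0 ?rpred0|by apply/matrixP => -[]].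
  by rewrite (_ : v = 0); [exact: sL.1|apply/matrixP => -[]].
move: L sL LZ; rewrite -[n.+1]/(1 + n)%N => L sL LZ.
pose L0 := [set v | L (col_mx (0 : 'cV_1) v)].
have sL0 : subgroup L0.
  split=> [|u v Lu Lv]; first by rewrite /L0/= col_mx0; exact: sL.1.
  have : L (col_mx (0 : 'cV_1) u - col_mx 0 v) by exact: sL.2.
  by rewrite opp_col_mx add_col_mx subrr.
have [v L0v|a [A0 [rA0 A0E]]] := IH L0 sL0.
  have vZ : col_mx (0 : 'cV_1) v \is a mxOver Num.int by exact: LZ.
  apply/mxOverP => i j; have := mxOverP vZ (rshift 1 i) j.
  by rewrite col_mxEd.
pose K : 'M[R]_(1, 1 + n) := row_mx 1%:M 0.
have KE (v : 'cV[R]_(1 + n)) : K *m v = usubmx v.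
  by rewrite -{1}[v]vsubmxK mul_row_col mul1mx mul0mx addr0.
have [||c [D bD]] := @ex_Zbasis_cV1 [set K *m v | v in L].
- split=> [|_ _ [u Lu <-] [v Lv <-]]; first by exists 0; rewrite ?mulmx0//; exact: sL.1.
  by exists (u - v); [exact: sL.2|rewrite mulmxBr].
- move=> _ [v Lv <-]; rewrite KE; apply/mxOverP => i j; rewrite mxE.
  exact: (mxOverP (LZ _ Lv)).
have mulA (z : 'cV[R]_a) :
    col_mx (0 : 'M[R]_(1, a)) A0 *m z = col_mx 0 (A0 *m z).
  by rewrite mul_col_mx mul0mx.
have bA : Zbasis [set v | L v /\ K *m v = 0] (col_mx (0 : 'M[R]_(1, a)) A0).
  split.
    apply/mxrank_colP => u; rewrite mulA => H.
    apply: (mxrank_colP A0).2 => //.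
    by rewrite -[LHS](col_mxKd (0 : 'cV_1)) H -(@col_mx0 _ 1 n) col_mxKd.
  apply/seteqP; split=> v.
    move=> [Lv]; rewrite KE => v0.
    have : L0 (dsubmx v) by rewrite /L0/= -v0 vsubmxK.
    rewrite A0E => -[z zZ zE]; exists z => //.
    by rewrite mulA zE -v0 vsubmxK.
  move=> [z zZ <-]; rewrite mulA; split; last by rewrite KE col_mxKu.
  have : Zspan A0 (A0 *m z) by exists z.
  by rewrite -A0E.
have [C _ bC] := Zbasis_extend sL bA bD.
by exists (a + c)%N, (row_mx (col_mx 0 A0) C).
Qed.

(** If [S] selects rows of [Z] forming an invertible block [W], then [1 - Z W^-1 S] vanishes exactly
    on the column span of [Z]. Multiplying it by [\det W] makes it integral. *)
Lemma ex_span_equation n k (Z : 'M[R]_(n, k)) :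
  Z \is a mxOver Num.int -> \rank Z = k ->
  exists2 K : 'M[R]_n, K \is a mxOver Num.int &
    forall m (X : 'M[R]_(n, m)), K *m X = 0 <-> exists Y, X = Z *m Y.
Proof.
move=> ZZ rZ; have fZ : row_full Z by rewrite /row_full rZ.
have := fullrowsub_unit fZ; set f := fullrankfun fZ; set W := rowsub f Z => uW.
have WZ : W \is a mxOver Num.int.
  by apply/mxOverP => i j; rewrite mxE (mxOverP ZZ).
have SZ : rowsub f 1%:M *m Z = W by rewrite mul_rowsub_mx mul1mx.
exists ((\det W)%:M - Z *m \adj W *m rowsub f 1%:M).
  rewrite mxOver_intB//.
    by rewrite mxOver_scalar ?rpred0 ?det_int.
  rewrite !mxOverM//; apply/mxOverP => i j.
    rewrite mxE /cofactor rpredM ?rpredX ?rpredN ?rpred1//.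
    by apply: det_int; apply/mxOverP => a b; rewrite !mxE (mxOverP ZZ).
  by rewrite !mxE; case: eqP => _; rewrite ?rpred0 ?rpred1.
move=> m X; split=> [|[Y ->]].
  move/eqP; rewrite mulmxBl subr_eq0 => /eqP H.
  exists ((\det W)^-1 *: (\adj W *m rowsub f 1%:M *m X)).
  rewrite -scalemxAr !mulmxA -H mul_scalar_mx scalerA mulVf ?scale1r//.
  by rewrite -unitfE -unitmxE.
rewrite mulmxA mulmxBl -!mulmxA SZ mul_adj_mx mul_mx_scalar mul_scalar_mx.
by rewrite subrr mul0mx.
Qed.

(** Up to sign, [\det U] is the index of the lattice of [Z] in that of [B], a nonzero integer. *)
Lemma gram_sublattice_le n k l (g : 'M[R]_n) (B : 'M[R]_(n, l))
    (Z : 'M[R]_(n, k)) (U : 'M[R]_(l, k)) :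
  l = k -> Z = B *m U -> U \is a mxOver Num.int -> \rank Z = k ->
  gram (g *m B) <= gram (g *m Z).
Proof.
move=> e; subst l => ZE UZ rZ.
rewrite ZE mulmxA gram_mulmx ler_peMr ?gram_ge0// sqr_intr_ge1 ?det_int//.
rewrite -unitfE -unitmxE -row_free_unit /row_free eqn_leq rank_leq_row /=.
by rewrite -[leqLHS]rZ ZE mxrankM_maxr.
Qed.

(* Integral bases adapted to the intersection and the sum of the saturations
   of two sublattices. *)
Lemma ex_adapted_basis n k k' (Z : 'M[R]_(n, k)) (Z' : 'M[R]_(n, k')) :
  Z \is a mxOver Num.int -> Z' \is a mxOver Num.int ->
  \rank Z = k -> \rank Z' = k' ->
  exists a c c' (A : 'M[R]_(n, a)) (C : 'M[R]_(n, c)) (C' : 'M[R]_(n, c')),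
  [/\ row_mx A (row_mx C C') \is a mxOver Num.int,
      \rank (row_mx A (row_mx C C')) = (a + (c + c'))%N,
      (exists X, A = Z *m X) /\ (exists X, A = Z' *m X),
      [/\ (a + c)%N = k, exists X, Z = row_mx A C *m X &
          forall g : 'M[R]_n, gram (g *m row_mx A C) <= gram (g *m Z)] &
      [/\ (a + c')%N = k', exists X, Z' = row_mx A C' *m X &
          forall g : 'M[R]_n, gram (g *m row_mx A C') <= gram (g *m Z')]].
Proof.
move=> ZZ ZZ' rZ rZ'.
have [K KZ HK] := ex_span_equation ZZ rZ.
have [K' KZ' HK'] := ex_span_equation ZZ' rZ'.
pose L (K : 'M[R]_n) := [set v : 'cV[R]_n | v \is a mxOver Num.int /\ K *m v = 0].
have sL M : subgroup (L M).
  split=> [|u v [uZ Mu] [vZ Mv]]; first by split; rewrite ?mulmx0 ?mxOver0 ?rpred0.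
  by split; [exact: mxOver_intB|rewrite mulmxBr Mu Mv subrr].
have sKL (M N : 'M[R]_n) : M \is a mxOver Num.int ->
    exists c (D : 'M[R]_(n, c)), Zbasis [set M *m v | v in L N] D.
  move=> MZ; apply: ex_Zbasis.
    split; first by exists 0; rewrite ?mulmx0//; exact: (sL N).1.
    move=> _ _ [u Lu <-] [v Lv <-].
    by exists (u - v); [exact: (sL N).2|rewrite mulmxBr].
  by move=> _ [v [vZ _] <-]; rewrite mxOverM.
(* [A] is a basis of the intersection of the two saturations [L K] and [L K']. *)
have [||a [A bA]] := @ex_Zbasis n [set v | L K v /\ K' *m v = 0].
- split=> [|u v [Lu Ku] [Lv Kv]]; first by split; rewrite ?mulmx0//; exact: (sL K).1.
  by split; [exact: (sL K).2|rewrite mulmxBr Ku Kv subrr].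
- by move=> v [[]].
have bA' : Zbasis [set v | L K' v /\ K *m v = 0] A.
  rewrite (_ : [set v | _] = [set v | L K v /\ K' *m v = 0])//.
  by apply/seteqP; split=> v [[]].
(* On [L K] the map [K'] has kernel spanned by [A], so lifting a basis of its image completes [A] to
   a basis of [L K]. Exchanging [K] and [K'] gives [C']. *)
have [c [D bD]] := sKL _ K KZ'.
have [c' [D' bD']] := sKL _ K' KZ.
have [C KC bC] := Zbasis_extend (sL K) bA bD.
have [C' KC' bC'] := Zbasis_extend (sL K') bA' bD'.
have colL M m (X : 'M[R]_(n, m)) : (forall j, L M (col j X)) ->
    X \is a mxOver Num.int /\ M *m X = 0.
  move=> H; split.
    apply/mxOverP => i j; have [/mxOverP/(_ i 0)] := H j.
    by rewrite mxE.
  apply/matrixP => i j; have [_ /matrixP/(_ i 0)] := H j; rewrite !mxE => MX.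
  by rewrite -[RHS]MX; apply: eq_bigr => l _; rewrite mxE.
have [ACZ KAC] : row_mx A C \is a mxOver Num.int /\ K *m row_mx A C = 0.
  by apply: colL => j; rewrite bC.2; exact: Zspan_col.
have [ACZ' KAC'] : row_mx A C' \is a mxOver Num.int /\ K' *m row_mx A C' = 0.
  by apply: colL => j; rewrite bC'.2; exact: Zspan_col.
have {}KA : K *m A = 0 by move: KAC; rewrite mul_mx_row -row_mx0 => /eq_row_mx[].
have {}KA' : K' *m A = 0 by move: KAC'; rewrite mul_mx_row -row_mx0 => /eq_row_mx[].
have half m l (M : 'M[R]_n) (Y : 'M[R]_(n, m)) (B : 'M[R]_(n, l)) :
    Y \is a mxOver Num.int -> \rank Y = m -> M *m Y = 0 ->
    (exists V, B = Y *m V) -> Zbasis (L M) B ->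
    [/\ l = m, exists X, Y = B *m X &
        forall g : 'M[R]_n, gram (g *m B) <= gram (g *m Y)].
  move=> YZ rY MY [V BV] [rB LB].
  have [|U UZ YU] := @Zspan_sub _ _ _ _ Y B.
    rewrite -LB => _ [z zZ <-]; split; first by rewrite mxOverM.
    by rewrite mulmxA MY mul0mx.
  have lm : l = m.
    apply/eqP; rewrite eqn_leq; apply/andP; split.
      by rewrite -[leqLHS]rB BV (leq_trans (mxrankM_maxl _ _))// rY.
    by rewrite -[leqLHS]rY YU (leq_trans (mxrankM_maxl _ _))// rB.
  by split=> // [|g]; [exists U|exact: (gram_sublattice_le _ _ YU)].
exists a, c, c', A, C, C'; split.
- apply/mxOverP => i j; rewrite mxE; case: splitP => l _.
    by have := mxOverP ACZ i (lshift c l); rewrite row_mxEl.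
  rewrite mxE; case: splitP => m _.
    by have := mxOverP ACZ i (rshift a m); rewrite row_mxEr.
  by have := mxOverP ACZ' i (rshift a m); rewrite row_mxEr.
- apply/mxrank_colP => u; rewrite -[u]vsubmxK -[dsubmx u]vsubmxK.
  (* [K] kills [A] and [C] and sends [C'] to [D'], whose columns are independent; this isolates the
     last coordinates. *)
  rewrite !mul_row_col => H; have u3 : dsubmx (dsubmx u) = 0.
    apply: (mxrank_colP D').2; first exact: bD'.1.
    have := congr1 (mulmx K) H; rewrite mulmx0 !mulmxDr !mulmxA KA KC'.
    move: KAC; rewrite mul_mx_row -row_mx0 => /eq_row_mx[_ ->].
    by rewrite !mul0mx !add0r.
  move: H; rewrite u3 mulmx0 addr0 -mul_row_col.
  move=> /((mxrank_colP _).2 bC.1).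
  by rewrite -col_mx0 => /eq_col_mx[-> ->]; rewrite !col_mx0.
- by split; [exact/HK|exact/HK'].
- by apply: (half _ _ K) => //; [apply/HK; exists 1%:M; rewrite mulmx1|exact/HK].
- by apply: (half _ _ K') => //; [apply/HK'; exists 1%:M; rewrite mulmx1|exact/HK'].
Qed.

End Sublattices.

(** * Pivot sets of column spans *)

Section Pivots.
Context {F : fieldType}.

(** The lexicographically first set of rows forming a basis of the row space. Its purpose is to turn
    a flag of column spans into a chain of sets. *)
Definition pivots n k (M : 'M[F]_(n, k)) : {set 'I_n} :=
  [set i | ~~ (row i M <= \sum_(j < n | (j < i)%N) <<row j M>>)%MS].

(** A row that depends on earlier rows still does so after right multiplication. *)
Lemma pivots_mulmx n k l (M : 'M[F]_(n, k)) (X : 'M[F]_(k, l)) :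
  pivots (M *m X) \subset pivots M.
Proof.
apply/fintype.subsetP => i; rewrite !inE; apply: contra => /(submxMr X).
rewrite -row_mul => /submx_trans; apply.
rewrite sumsmxMr_gen; apply/sumsmx_subP => j ji; rewrite genmxE.
apply: (sumsmx_sup j) => //; rewrite genmxE.
by rewrite row_mul submxMr// genmxE.
Qed.

Lemma mxrank_adds_row n k (A : 'M[F]_(n, k)) (v : 'rV[F]_k) :
  \rank (A + v)%MS = (~~ (v <= A)%MS + \rank A)%N.
Proof.
have [vA|vA] := boolP (v <= A)%MS; first by rewrite (addsmx_idPl vA).
apply/eqP; rewrite eqn_leq add1n; apply/andP; split.
  have := mxrank_adds_leqif A v; rewrite rank_rV => -[/leq_trans + _]; apply.
  by rewrite addnC -[leqRHS]add1n leq_add2r; case: (_ == _).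
rewrite (ltn_leqif (mxrank_leqif_sup (addsmxSl A v))).
by apply: contra vA; exact: submx_trans (addsmxSr A v).
Qed.

(** Adding the rows one at a time raises the rank by one exactly at the pivots. *)
Lemma card_pivots n k (M : 'M[F]_(n, k)) : #|pivots M| = \rank M.
Proof.
pose S m := (\sum_(j < n | (j < m)%N) <<row j M>>)%MS.
have SM : (S n :=: M)%MS.
  apply/eqmxP/andP; split.
    by apply/sumsmx_subP => j _; rewrite genmxE row_sub.
  by apply/row_subP => i; apply: (sumsmx_sup i); rewrite ?genmxE.
suff H m : (m <= n)%N -> #|[set i in pivots M | (i < m)%N]| = \rank (S m).
  rewrite -SM -H//; apply: eq_card => i.
  by rewrite inE ltn_ord andbT.
elim: m => [_|m IH mn].
  rewrite /S big_pred0// mxrank0; apply: eq_card0 => i.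
  by rewrite inE andbF.
pose i := Ordinal mn.
have -> : \rank (S m.+1) = \rank (S m + row i M)%MS.
  rewrite /S (bigD1 i)//= addsmxC.
  rewrite (eq_bigl (fun j : 'I_n => (j < m)%N)); last first.
    by move=> j; rewrite ltnS ltn_neqAle andbC.
  by rewrite (adds_eqmx (eqmx_refl _) (genmxE _)).
rewrite mxrank_adds_row -(IH (ltnW mn)) (cardsD1 i); congr (_ + _)%N.
  by rewrite !inE ltnSn andbT.
apply: eq_card => j; rewrite in_setD1; move: (pivots M) => I.
by rewrite !inE ltnS [in RHS]ltn_neqAle andbCA.
Qed.

(** By strong induction on its index, every row lies in the span of the pivot rows, so the minor on
    the pivots is nonzero. *)
Lemma ex_pivots_minor n k (M : 'M[F]_(n, k)) : \rank M = k ->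
  exists2 f : {ffun 'I_k -> 'I_n}, \det (rowsub f M) != 0 &
    forall (V : nmodType) (t : 'I_n -> V),
      \sum_i t (f i) = \sum_(j in pivots M) t j.
Proof.
move=> rM; have cM : k = #|pivots M| by rewrite card_pivots.
pose f : {ffun 'I_k -> 'I_n} := [ffun i => enum_val (cast_ord cM i)].
have fM : (M <= rowsub f M)%MS.
  apply/row_subP => i; have [m] := ubnP (i : nat); elim: m i => // m IH i im.
  have [ip|] := boolP (i \in pivots M); last first.
    rewrite inE negbK => /submx_trans; apply; apply/sumsmx_subP => j ji.
    by rewrite genmxE IH// (leq_trans ji).
  have -> : row i M = row (cast_ord (esym cM) (enum_rank_in ip i)) (rowsub f M).
    by rewrite row_rowsub ffunE cast_ordKV enum_rankK_in.
  exact: row_sub.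
exists f => [|V t].
  rewrite -unitfE -unitmxE -row_full_unit /row_full eqn_leq rank_leq_col /=.
  by rewrite -[leqLHS]rM mxrankS.
rewrite [RHS]big_enum_val (reindex (cast_ord cM))/=.
  by apply: eq_bigr => i _; rewrite ffunE.
by exists (cast_ord (esym cM)) => i _; rewrite (cast_ordK, cast_ordKV).
Qed.

End Pivots.

(** * Convexity along the diagonal flow and directions of ascent *)

Section AscentDirection.

Lemma sum_fibers (R : realType) n k (f : 'I_k -> 'I_n) (t : 'rV[R]_n) :
  \sum_(j < n) (\sum_l (f l == j)%:R) * t 0 j = \sum_l t 0 (f l).
Proof.
under eq_bigr do rewrite mulr_suml.
rewrite exchange_big; apply: eq_bigr => l _ /=.
rewrite (bigD1 (f l))//= eqxx mul1r big1 ?addr0// => j.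
by rewrite eq_sym => /negPf ->; rewrite mul0r.
Qed.

(* Half the derivative at s = 0 of k! gram (diag_exp (s *: t) *m M). *)
Definition gram_slope (R : comNzRingType) n k (M : 'M[R]_(n, k))
    (t : 'rV[R]_n) : R :=
  \sum_(f : {ffun 'I_k -> 'I_n}) \det (rowsub f M) ^+ 2 * \sum_l t 0 (f l).

Definition diag_exp (R : realType) n (t : 'rV[R]_n) : 'M[R]_n :=
  diag_mx (map_mx expR t).

Lemma gram_diag_exp (R : realType) n k (M : 'M[R]_(n, k)) (t : 'rV[R]_n) :
  k`!%:R * gram (diag_exp t *m M) =
  \sum_(f : {ffun 'I_k -> 'I_n})
     expR (2 * \sum_l t 0 (f l)) * \det (rowsub f M) ^+ 2.
Proof.
rewrite gram_diag; apply: eq_bigr => f _; congr (_ * _).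
under eq_bigr do rewrite mxE.
by rewrite -expR_sum expRM_natl.
Qed.

(** Apply [1 + x <= expR x] to each Cauchy-Binet term: the linear parts add up to twice the
    slope. *)
Lemma gram_diag_exp_ge (R : realType) n k (M : 'M[R]_(n, k)) (t : 'rV[R]_n) :
  0 <= gram_slope M t -> gram M <= gram (diag_exp t *m M).
Proof.
move=> Mt; rewrite -(@ler_pM2l _ k`!%:R) ?ltr0n ?fact_gt0//.
rewrite gram_diag_exp gramE.
apply: (@le_trans _ _ (\sum_(f : {ffun 'I_k -> 'I_n})
  (1 + 2 * \sum_l t 0 (f l)) * \det (rowsub f M) ^+ 2)); last first.
  by apply: ler_sum => f _; rewrite ler_wpM2r ?sqr_ge0// expR_ge1Dx.
under [leRHS]eq_bigr do rewrite mulrDl mul1r.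
rewrite big_split/= lerDl.
under eq_bigr do rewrite -mulrA [_ * \det _ ^+ 2]mulrC.
by rewrite -mulr_sumr mulr_ge0.
Qed.

(** Strictness comes from a positive slope or from the term of [f], where [1 + x < expR x] because
    the exponent is nonzero. *)
Lemma gram_diag_exp_gt (R : realType) n k (M : 'M[R]_(n, k)) (t : 'rV[R]_n)
    (f : {ffun 'I_k -> 'I_n}) :
  0 <= gram_slope M t -> \det (rowsub f M) != 0 ->
  0 < gram_slope M t \/ \sum_l t 0 (f l) != 0 ->
  gram M < gram (diag_exp t *m M).
Proof.
move=> Mt fM H; rewrite -(@ltr_pM2l _ k`!%:R) ?ltr0n ?fact_gt0//.
rewrite gram_diag_exp gramE.
have E : \sum_(f : {ffun 'I_k -> 'I_n})
    (1 + 2 * \sum_l t 0 (f l)) * \det (rowsub f M) ^+ 2 =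
    \sum_(f : {ffun 'I_k -> 'I_n}) \det (rowsub f M) ^+ 2 + 2 * gram_slope M t.
  under eq_bigr do rewrite mulrDl mul1r.
  rewrite big_split/=; congr (_ + _).
  by under eq_bigr do rewrite -mulrA [_ * \det _ ^+ 2]mulrC; rewrite -mulr_sumr.
case: H => [{}Mt|tf].
  apply: (@lt_le_trans _ _ (\sum_(f : {ffun 'I_k -> 'I_n})
    (1 + 2 * \sum_l t 0 (f l)) * \det (rowsub f M) ^+ 2)); last first.
    by apply: ler_sum => g _; rewrite ler_wpM2r ?sqr_ge0// expR_ge1Dx.
  by rewrite E ltrDl mulr_gt0.
apply: (@le_lt_trans _ _ (\sum_(f : {ffun 'I_k -> 'I_n})
  (1 + 2 * \sum_l t 0 (f l)) * \det (rowsub f M) ^+ 2)).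
  by rewrite E lerDl mulr_ge0.
rewrite (bigD1 f)//= [ltRHS](bigD1 f)//= ltr_leD//.
  by rewrite ltr_pM2r ?exprn_even_gt0//= expR_gt1Dx// mulf_neq0.
by apply: ler_sum => g _; rewrite ler_wpM2r ?sqr_ge0// expR_ge1Dx.
Qed.

Lemma gram_slopeZ (R : comNzRingType) n k (M : 'M[R]_(n, k)) (t : 'rV[R]_n) s :
  gram_slope M (s *: t) = s * gram_slope M t.
Proof.
rewrite mulr_sumr; apply: eq_bigr => f _; rewrite mulrCA; congr (_ * _).
by rewrite mulr_sumr; apply: eq_bigr => l _; rewrite mxE.
Qed.

(** In a linear relation, take the largest set with nonzero coefficient: an element of it outside
    the next largest such set forces that coefficient to vanish. *)
Lemma row_free_chain (F : fieldType) m n (I : 'I_m -> {set 'I_n}) :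
  (forall i, 0 < #|I i|)%N -> injective (fun i => #|I i|) ->
  (forall i j, (#|I i| <= #|I j|)%N -> I i \subset I j) ->
  row_free (\matrix_(i, j) (j \in I i)%:R : 'M[F]_(m, n)).
Proof.
move=> I0 injI subI; rewrite -kermx_eq0; apply/eqP/row_matrixP => r.
rewrite row0; set u := row r _.
have uJ : u *m (\matrix_(i, j) (j \in I i)%:R : 'M[F]_(m, n)) = 0.
  by rewrite -row_mul mulmx_ker row0.
apply/eqP; apply: contraT => /rV0Pn[i1 ui1].
pose i := [arg max_(i > i1 | u 0 i != 0) #|I i|].
have [ui imax] : u 0 i != 0 /\ forall j, u 0 j != 0 -> (#|I j| <= #|I i|)%N.
  by rewrite /i; case: arg_maxnP.
have [x xi xj] : exists2 x, x \in I i &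
    forall j, j != i -> u 0 j != 0 -> x \notin I j.
  have [[j0 /andP[ji0 uj0]]|nj] := pselect (exists j, (j != i) && (u 0 j != 0)).
    pose j := [arg max_(j > j0 | (j != i) && (u 0 j != 0)) #|I j|].
    have [/andP[ji uj] jmax] : ((j != i) && (u 0 j != 0)) /\
        forall l, (l != i) && (u 0 l != 0) -> (#|I l| <= #|I j|)%N.
      by rewrite /j; case: arg_maxnP; rewrite ?ji0.
    have : I j \proper I i.
      rewrite properEcard subI ?imax//= ltn_neqAle imax// andbT.
      by apply: contra ji => /eqP/injI ->.
    move=> /properP[_ [x xi xj]]; exists x => // l li ul.
    by apply: contra xj; apply/fintype.subsetP/subI/jmax; rewrite li.
  have /card_gt0P[x xi] := I0 i; exists x => // j ji uj.
  by case: nj; exists j; rewrite ji.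
move/matrixP/(_ 0 x)/eqP: uJ; rewrite !mxE (bigD1 i)//= mxE xi mulr1.
rewrite big1 ?addr0 ?(negPf ui)// => j ji; rewrite mxE.
have [->|uj] := eqVneq (u 0 j) 0; first by rewrite mul0r.
by rewrite (negPf (xj j ji uj)) mulr0.
Qed.

(** If [P] has dependent rows, its row space is too small to contain that of [J], so some vector of
    the kernel of [P] is not killed by [J]. *)
Lemma solvable_or_kernel (F : fieldType) m n (P J : 'M[F]_(m, n))
    (e : 'cV[F]_m) : row_free J ->
  (exists t : 'cV_n, P *m t = e) \/ (exists2 t : 'cV_n, P *m t = 0 & J *m t != 0).
Proof.
move=> fJ; have [/row_freeP[Q PQ]|nP] := boolP (row_free P).
  by left; exists (Q *m e); rewrite mulmxA PQ mul1mx.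
right; have : J *m cokermx P != 0.
  rewrite -submxE; apply: contra nP => /mxrankS.
  by rewrite (eqP fJ) /row_free eqn_leq rank_leq_row => ->.
move=> /matrix0Pn[i [j ij]]; exists (col j (cokermx P)).
  by rewrite colE mulmxA mulmx_coker mul0mx.
apply/matrix0Pn; exists i, 0; rewrite colE mulmxA -colE.
by rewrite mxE.
Qed.

(* First-order ascent is possible when the slopes are linearly independent.
   Otherwise some t is orthogonal to all of them, and by strict convexity it
   suffices that t is not orthogonal to the indicators of the nested pivot
   sets, which are always independent. *)
Lemma ex_ascent_direction (R : realType) n m (k : 'I_m -> nat)
    (M : forall i, 'M[R]_(n, k i)) (i0 i1 : 'I_m) :
  k i0 = n -> i1 != i0 -> injective k -> (forall i, 0 < k i)%N ->
  (forall i, \rank (M i) = k i) ->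
  (forall i j, (k i <= k j)%N -> exists X, M i = M j *m X) ->
  exists t : 'rV[R]_n,
    [/\ \sum_j t 0 j = 0,
        forall s i, 0 < s -> gram (M i) <= gram (diag_exp (s *: t) *m M i) &
        exists2 i, i != i0 &
          forall s, 0 < s -> gram (M i) < gram (diag_exp (s *: t) *m M i)].
Proof.
move=> ki0 i10 injk k0 rM chain.
pose I i := pivots (M i).
have cI i : #|I i| = k i by rewrite card_pivots.
have fJ : row_free (\matrix_(i, j) (j \in I i)%:R : 'M[R]_(m, n)).
  apply: row_free_chain => [i|i j|i j]; rewrite !cI//; first exact: injk.
  by move=> /chain[X MX]; rewrite /I MX; exact: pivots_mulmx.
have I0T : I i0 = [set: 'I_n]%SET.
  by apply/eqP; rewrite eqEcard finset.subsetT cardsT card_ord cI ki0 leqnn.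
(* The row of [i0] encodes the trace of [t], the other rows the slopes. *)
pose P : 'M[R]_(m, n) := \matrix_(i, j) (if i == i0 then 1 else
  \sum_(f : {ffun 'I_(k i) -> 'I_n})
    \det (rowsub f (M i)) ^+ 2 * \sum_l (f l == j)%:R).
have P0 (t : 'cV_n) : (P *m t) i0 0 = \sum_j t j 0.
  by rewrite mxE; apply: eq_bigr => j _; rewrite mxE eqxx mul1r.
have PE (t : 'cV_n) i : i != i0 -> (P *m t) i 0 = gram_slope (M i) t^T.
  move=> ii0; rewrite mxE; under eq_bigr do rewrite mxE (negPf ii0) mulr_suml.
  rewrite exchange_big; apply: eq_bigr => f _ /=.
  rewrite -(sum_fibers f t^T) mulr_sumr; apply: eq_bigr => j _.
  by rewrite mulrA mxE.
have slope0 (t : 'cV_n) s i : 0 < s -> \sum_j t j 0 = 0 ->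
    (i != i0 -> 0 <= (P *m t) i 0) ->
    gram (M i) <= gram (diag_exp (s *: t^T) *m M i).
  move=> s0 t0 Pt; have [->|ii0] := eqVneq i i0.
    move: (M i0); rewrite ki0 => N; rewrite !gram_square det_mulmx.
    rewrite det_diag (eq_bigr (fun j => expR (s * t j 0))); last first.
      by move=> j _; rewrite !mxE.
    by rewrite -expR_sum -mulr_sumr t0 mulr0 expR0 mul1r.
  apply: gram_diag_exp_ge; rewrite gram_slopeZ mulr_ge0 ?(ltW s0)//.
  by rewrite -PE// Pt.
(* Trace zero and all other slopes equal to 1. *)
pose e : 'cV[R]_m := \col_i (i != i0)%:R.
have [[t Pt]|[t Pt Jt]] := solvable_or_kernel P e fJ.
  have t0 : \sum_j t j 0 = 0 by rewrite -P0 Pt mxE eqxx.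
  exists t^T; split.
  - by rewrite -[RHS]t0; apply: eq_bigr => j _; rewrite mxE.
  - by move=> s i s0; apply: slope0 => // ii0; rewrite Pt mxE ler0n.
  - exists i1 => // s s0.
    have st : 0 < gram_slope (M i1) (s *: t^T).
      by rewrite gram_slopeZ mulr_gt0// -PE// Pt mxE i10 ltr01.
    have [f fM _] := ex_pivots_minor (rM i1).
    by apply: (gram_diag_exp_gt _ fM) => //; [exact: ltW|left].
have t0 : \sum_j t j 0 = 0 by rewrite -P0 Pt mxE.
exists t^T; split.
- by rewrite -[RHS]t0; apply: eq_bigr => j _; rewrite mxE.
- by move=> s i s0; apply: slope0 => // ii0; rewrite Pt mxE.
move: Jt => /matrix0Pn[i [j]]; rewrite ord1 mxE => Jt.
have {}Jt : \sum_(j in I i) t j 0 != 0.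
  move: Jt; rewrite [X in _ -> X != 0]big_mkcond/=.
  rewrite (eq_bigr (fun j => if j \in I i then t j 0 else 0))//.
  by move=> l _; rewrite mxE; case: ifP => _; rewrite ?mul1r ?mul0r.
(* The indicator of [I i0] is constantly 1, and pairs to zero with [t] of trace zero. *)
have ii0 : i != i0.
  apply: contraNneq Jt => ->; rewrite I0T.
  by rewrite (eq_bigl predT) ?t0// => l; rewrite inE.
exists i => // s s0.
have [f fM fE] := ex_pivots_minor (rM i).
have st : gram_slope (M i) (s *: t^T) = 0.
  by rewrite gram_slopeZ -PE// Pt mxE mulr0.
apply: (gram_diag_exp_gt _ fM); rewrite st//; right.
rewrite (fE _ (fun j => (s *: t^T) 0 j)).
under eq_bigr do rewrite !mxE.
by rewrite -mulr_sumr mulf_neq0// gt_eqF.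
Qed.

End AscentDirection.

(** * Reduction of quadratic forms and bounded bases *)

Section Reduction.
Context {R : realType}.

(** Squaring the determinant admits both signs, as exchanging two basis vectors requires. *)
Definition unimodular n (A : 'M[R]_n) : Prop :=
  A \is a mxOver Num.int /\ \det A ^+ 2 = 1.

Lemma unimodular1 n : unimodular (1%:M : 'M[R]_n).
Proof. by rewrite /unimodular det1 expr1n mxOver_scalar ?rpred0 ?rpred1. Qed.

Lemma unimodularM n (A B : 'M[R]_n) :
  unimodular A -> unimodular B -> unimodular (A *m B).
Proof.
move=> [AZ A1] [BZ B1]; split; first by rewrite mxOverM.
by rewrite det_mulmx exprMn A1 B1 mulr1.
Qed.

Lemma unimodular_tperm n (i j : 'I_n) : unimodular (tperm_mx i j : 'M[R]_n).
Proof.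
split; last by rewrite det_perm sqrr_sign.
apply/mxOverP => k l; rewrite !mxE.
by case: (_ == _); rewrite ?rpred0 ?rpred1.
Qed.

Lemma form_tperm n (G B : 'M[R]_n) i j :
  ((B *m tperm_mx i j)^T *m G *m (B *m tperm_mx i j)) i i =
  (B^T *m G *m B) j j.
Proof.
rewrite trmx_mul tr_tperm_mx !mulmxA -xcolE -!(mulmxA (tperm_mx _ _)) -xrowE.
by rewrite [LHS]mxE [LHS]mxE !tpermL.
Qed.

Lemma unimodular_block n (m : 'rV[R]_n) (A : 'M[R]_n) :
  m \is a mxOver Num.int -> unimodular A ->
  unimodular (block_mx 1%:M m 0 A : 'M[R]_(1 + n)).
Proof.
move=> mZ [AZ A1]; split; last by rewrite det_ublock det1 mul1r.
apply/mxOverP => i j; rewrite mxE; case: splitP => k _; rewrite mxE.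
  case: splitP => l _; last by rewrite (mxOverP mZ).
  by rewrite mxE; case: (_ == _); rewrite ?rpred0 ?rpred1.
by case: splitP => l _; rewrite ?(mxOverP AZ)// mxE rpred0.
Qed.

(** Some element lies below 4/3 of the positive infimum. An almost minimum suffices for reduction,
    so the minimum need not be attained. *)
Lemma ex_approx_min (S : set R) c : 0 < c -> S !=set0 ->
  (forall x, S x -> c <= x) ->
  exists2 a, S a & forall x, S x -> 3 / 4 * a <= x.
Proof.
move=> c0 S0 cS; have infS : has_inf S by split=> //; exists c.
have cinf : c <= inf S by apply: lb_le_inf.
have [|a Sa ainf] := @inf_adherent _ S (inf S / 3) _ infS.
  by rewrite divr_gt0// (lt_le_trans c0).
exists a => // x Sx; have : inf S <= x by apply: ge_inf => //; exists c.
by lra.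
Qed.

Lemma ex_rounding n (b : 'rV[R]_n) :
  exists2 m : 'rV[R]_n, m \is a mxOver Num.int &
    forall i, (m + b) 0 i ^+ 2 <= 1 / 4.
Proof.
exists (\row_i - (Num.floor (b 0 i + 1 / 2))%:~R).
  by apply/mxOverP => i j; rewrite mxE rpredN intr_int.
move=> i; rewrite !mxE; have := floor_itv (b 0 i + 1 / 2).
rewrite intrD mulr1z; set x := (Num.floor _)%:~R => /andP[xy yx].
have [? ?] : - (1 / 2) <= - x + b 0 i /\ - x + b 0 i <= 1 / 2 by split; lra.
by nra.
Qed.

(* Hermite reduction: take an almost shortest vector first, then reduce the
   Schur complement. *)
Lemma ex_reduced_form n (c d : R) : 0 < c ->
  exists C, forall G : 'M[R]_n.+1, G^T = G -> \det G <= d ->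
    (forall A, unimodular A -> c <= (A^T *m G *m A) 0 0) ->
    exists2 A, unimodular A & forall i, (A^T *m G *m A) i i <= C.
Proof.
elim: n c d => [|n IH] c d c0.
  exists d => G _ Gd _; exists 1%:M; first exact: unimodular1.
  by move=> i; rewrite trmx1 mul1mx mulmx1 ord1 -det_mx11.
(* Bounds for the Schur complement [H]: its values are at least [a / 2 >= c / 2], and its
   determinant is that of the form divided by [a >= c]. *)
have [|C IHC] := IH (c / 2) (`|d| / c); first by rewrite divr_gt0.
exists (2 * C).
rewrite -[n.+2]/(1 + n.+1)%N => G GT Gd cG.
pose S := [set x | exists2 A, unimodular A & x = (A^T *m G *m A) 0 0].
have [||a [A0 uA0 aE] amin] := @ex_approx_min S c c0.
- by exists ((1%:M^T *m G *m 1%:M) 0 0), 1%:M => //; exact: unimodular1.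
- by move=> _ [A uA ->]; exact: cG.
have ca : c <= a by rewrite aE; exact: cG.
have a0 : 0 < a by exact: lt_le_trans ca.
pose G1 := A0^T *m G *m A0.
have G1T : G1^T = G1 by rewrite /G1 !trmx_mul trmxK GT mulmxA.
(* Completing the square: shearing by [be] removes the mixed terms and leaves [a] and [H]. *)
pose b : 'rV[R]_n.+1 := ursubmx G1.
pose be := a^-1 *: b; pose H := drsubmx G1 - b^T *m be.
have G1E : G1 = block_mx a%:M b b^T (drsubmx G1).
  rewrite -[LHS]submxK; congr block_mx.
    rewrite [LHS]mx11_scalar aE -/G1 [ulsubmx _ _ _]mxE [usubmx _ _ _]mxE.
    by rewrite (_ : lshift _ 0 = 0)//; exact: val_inj.
  by rewrite -[in LHS]G1T -trmx_ursub.
have aV : a * a^-1 = 1 by rewrite mulfV ?gt_eqF.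
have Va : a^-1 * a = 1 by rewrite mulVf ?gt_eqF.
pose U : 'M[R]_(1 + n.+1) := block_mx 1%:M be 0 1%:M.
have G1U : G1 = U^T *m block_mx a%:M 0 0 H *m U.
  rewrite G1E tr_block_mx !mulmx_block !trmx1 !trmx0 !mul1mx !mul0mx !mulmx0.
  rewrite !mulmx1 !addr0 !add0r mul_scalar_mx mul_mx_scalar.
  rewrite !scalerA ?linearZ/= aV !scale1r; congr block_mx.
    by rewrite scalerA Va scale1r.
  by rewrite scalerA Va scale1r /H /be -scalemxAr addrC subrK.
have detH : \det H <= `|d| / c.
  have : \det G1 = a * \det H.
    rewrite G1U !det_mulmx det_tr det_ublock !det1 mulr1 mul1r mulr1.
    by rewrite det_ublock det_scalar1.
  rewrite /G1 !det_mulmx det_tr mulrAC -expr2 uA0.2 mul1r => detG.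
  have [H0|H0] := leP (\det H) 0.
    by rewrite (le_trans H0)// divr_ge0// ltW.
  rewrite ler_pdivlMr// mulrC (le_trans _ (ler_norm d))// (le_trans _ Gd)//.
  by rewrite detG ler_pM2r.
have G1A (A : 'M[R]_n.+1) (m : 'rV[R]_n.+1) :
    (A0 *m block_mx 1%:M m 0 A)^T *m G *m (A0 *m block_mx 1%:M m 0 A) =
    block_mx a%:M (a *: (m + be *m A)) (a *: (m + be *m A)^T)
      (a *: ((m + be *m A)^T *m (m + be *m A)) + A^T *m H *m A).
  have -> : (A0 *m block_mx 1%:M m 0 A)^T *m G *m (A0 *m block_mx 1%:M m 0 A) =
      (U *m block_mx 1%:M m 0 A)^T *m block_mx a%:M 0 0 H *m
      (U *m block_mx 1%:M m 0 A).
    rewrite !trmx_mul !mulmxA -(mulmxA _ A0^T) -(mulmxA _ (A0^T *m G)) -/G1.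
    by rewrite G1U !mulmxA.
  rewrite mulmx_block !mul1mx !mul0mx !mulmx0 !addr0 !add0r.
  rewrite tr_block_mx !mulmx_block !trmx1 !trmx0 !mul1mx !mul0mx !mulmx0.
  rewrite !mulmx1 !addr0 !add0r mul_scalar_mx mul_mx_scalar.
  by rewrite mul0mx addr0 [in RHS]scalemxAl.
have G1Ai (A : 'M[R]_n.+1) (m : 'rV[R]_n.+1) i :
    ((A0 *m block_mx 1%:M m 0 A)^T *m G *m (A0 *m block_mx 1%:M m 0 A))
      (rshift 1 i) (rshift 1 i) =
    a * (m + be *m A) 0 i ^+ 2 + (A^T *m H *m A) i i.
  rewrite G1A block_mxEdr [LHS]mxE; congr (_ + _).
  by rewrite [LHS]mxE [X in _ * X]mxE big_ord1 [_^T _ _]mxE expr2.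
(* After rounding, the second basis vector has value at most [a / 4] plus the value of [H]. Moved to
   first place by [T], it has value at least [3 / 4 * a], which leaves [a / 2] for [H]. *)
have aH A : unimodular A -> a / 2 <= (A^T *m H *m A) 0 0.
  move=> uA; have [m mZ mA] := ex_rounding (be *m A).
  pose B := A0 *m block_mx 1%:M m 0 A.
  have uB : unimodular B by apply: unimodularM => //; exact: unimodular_block.
  pose T : 'M[R]_(1 + n.+1) := tperm_mx (lshift n.+1 0) (rshift 1 0).
  have : 3 / 4 * a <= (B^T *m G *m B) (rshift 1 0) (rshift 1 0).
    apply: amin; exists (B *m T); first exact/unimodularM/unimodular_tperm.
    rewrite -[LHS](form_tperm _ _ (lshift n.+1 0)).
    by rewrite /T (_ : lshift _ 0 = 0)//; exact: val_inj.
  rewrite G1Ai; have := mA 0; move: (_ 0 0) => x x2.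
  have : a * x ^+ 2 <= a * (1 / 4) by rewrite ler_pM2l.
  by lra.
have HT : H^T = H.
  rewrite /H /be linearB /= trmx_drsub G1T -scalemxAr linearZ /= trmx_mul trmxK.
  by [].
have [|A uA AC] := IHC H HT detH.
  by move=> A uA; apply: le_trans (aH A uA); lra.
have [m mZ mA] := ex_rounding (be *m A).
have aC : a <= 2 * C by have := aH A uA; have := AC 0; lra.
exists (A0 *m block_mx 1%:M m 0 A).
  by apply: unimodularM => //; exact: unimodular_block.
move=> i; rewrite -[i]fintype.splitK; case: (fintype.split i) => j /=.
  by rewrite G1A block_mxEul !mxE ord1 eqxx.
rewrite G1Ai; have := AC j; have := mA j; move: (_ 0 j) => x x2.
have : a * x ^+ 2 <= a * (1 / 4) by rewrite ler_pM2l.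
by lra.
Qed.

Lemma det_diag_first n (x : R) :
  \det (diag_mx (\row_(j < n.+1) (if j == 0 then x else 1))) = x.
Proof.
rewrite det_diag big_ord_recl mxE eqxx big1 ?mulr1// => j _.
by rewrite mxE.
Qed.

(** The form [g^T *m g] takes squared lengths as values, so its reduction bounds the columns of
    [g *m A]. *)
Lemma ex_bounded_representative n (c : R) : 0 < c ->
  exists C, forall g : 'M[R]_n.+1, \det g = 1 ->
    (forall z : 'cV_n.+1, z \is a mxOver Num.int -> \rank z = 1%N ->
       c <= gram (g *m z)) ->
    exists A, [/\ A \is a mxOver Num.int, \det A = 1 &
      forall i j, `|(g *m A) i j| <= C].
Proof.
move=> c0; have [C HC] := ex_reduced_form n 1 c0.
(* The added 1 serves to pass from squares to absolute values by [x <= x ^+ 2 + 1]. *)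
exists (C + 1) => g g1 gc.
have GE A i : (A^T *m (g^T *m g) *m A) i i = \sum_j (g *m A) j i ^+ 2.
  rewrite mulmxA -trmx_mul -mulmxA mxE; apply: eq_bigr => j _.
  by rewrite [_^T _ _]mxE expr2.
have [|||A [AZ A1] AC] := HC (g^T *m g).
- by rewrite trmx_mul trmxK.
- by rewrite det_mulmx det_tr g1 mulr1.
- move=> A [AZ A1]; have uA : A \in unitmx.
    by rewrite unitmxE unitfE -sqrf_eq0 A1 oner_eq0.
  have := gc (col 0 A).
  have -> : g *m col 0 A = col 0 (g *m A) by rewrite !colE mulmxA.
  have -> : gram (col 0 (g *m A)) = (A^T *m (g^T *m g) *m A) 0 0.
    rewrite GE /gram det_mx11 mxE; apply: eq_bigr => j _.
    by rewrite !mxE expr2.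
  apply; first by apply/mxOverP => i j; rewrite mxE (mxOverP AZ).
  rewrite -mxrank_tr tr_col rank_rV; apply/eqP; rewrite eqb1.
  apply: contraTneq uA => A0; rewrite -unitmx_tr -row_free_unit.
  apply/negP => /row_freeP[B /(congr1 (row 0))].
  rewrite row_mul A0 mul0mx => /rowP/(_ 0); rewrite !mxE eqxx => /eqP.
  by rewrite eq_sym oner_eq0.
(* Multiplying the first column by the sign [\det A] makes the determinant 1. *)
pose D := diag_mx (\row_(j < n.+1) (if j == 0 then \det A else 1)).
exists (A *m D); split.
- rewrite mxOverM// mxOver_diag ?rpred0//; apply/mxOverP => i j; rewrite mxE.
  by case: ifP; rewrite ?rpred1 ?det_int.
- by rewrite det_mulmx det_diag_first -expr2.
move=> i j; rewrite mulmxA mul_mx_diag mxE normrM.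
have -> : `|(\row_j0 (if j0 == 0 then \det A else 1)) 0 j| = 1 :> R.
  rewrite mxE; case: ifP => _; last by rewrite normr1.
  apply/eqP; rewrite -(@pexpr_eq1 _ _ 2)//.
  by rewrite real_normK ?num_real ?A1.
have := AC j; rewrite GE (bigD1 i)//= mulr1.
set x := (g *m A) i j; set y := \sum_(_ | _) _.
have y0 : 0 <= y by apply: sumr_ge0 => l _; exact: sqr_ge0.
rewrite -[x ^+ 2]real_normK ?num_real//; have := normr_ge0 x.
by nra.
Qed.

End Reduction.

(** * Semistability and the flow that removes destabilizing ranks *)

Section Semistability.
Context {R : realType}.

(* The case th = 1 is stability of g Z^n; the argument needs the exponent to be
   strictly concave in the rank k and to vanish at k = 0 and k = n. *)
Definition semistable n (th : R) (g : 'M[R]_n) : Prop :=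
  forall k (Z : 'M[R]_(n, k)), Z \is a mxOver Num.int -> \rank Z = k ->
    th ^+ (k * (n - k)) <= gram (g *m Z).

Definition destabilizing n (th : R) (g : 'M[R]_n) k (Z : 'M[R]_(n, k)) : Prop :=
  [/\ Z \is a mxOver Num.int, \rank Z = k &
      gram (g *m Z) = th ^+ (k * (n - k))].

Lemma gram_int_det1 n (g : 'M[R]_n) k (Z : 'M[R]_(n, k)) : \det g = 1 ->
  Z \is a mxOver Num.int -> \rank Z = k -> (k * (n - k) = 0)%N ->
  1 <= gram (g *m Z).
Proof.
move=> g1 ZZ rZ /eqP; rewrite muln_eq0 => /orP[/eqP k0|nk].
  by subst k; rewrite /gram det_mx00.
have kn : k = n.
  by apply/eqP; rewrite eqn_leq -(subn_eq0 n) nk andbT -rZ rank_leq_row.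
subst k; rewrite gram_mulmx gram_square g1 expr1n mul1r -gram_square.
exact: gram_int_ge1.
Qed.

(** Integral matrices of full rank have Gram determinant at least 1, and [g] shrinks it by a bounded
    factor. [s] dominates these factors for all ranks. *)
Lemma ex_semistable n (g : 'M[R]_n) : \det g = 1 ->
  exists2 th, 0 < th <= 1 & semistable th g.
Proof.
move=> g1; have gu : g \in unitmx by rewrite unitmxE g1 unitr1.
have /choice[c Hc] k : exists c, 0 < c /\
    forall M : 'M[R]_(n, k), gram (invmx g *m M) <= c * gram M.
  by have [c c0 Hc] := gram_mulmx_le (invmx g) k; exists c.
have sumc k : (k <= n)%N -> c k <= 1 + \sum_(j < n.+1) c j.
  rewrite -ltnS => kn; rewrite (bigD1 (Ordinal kn))//= addrCA lerDl.
  by rewrite addr_ge0// sumr_ge0// => j _; exact/ltW/(Hc j).1.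
set s := 1 + _ in sumc.
have s1 : 1 <= s by rewrite lerDl sumr_ge0// => j _; exact/ltW/(Hc j).1.
have s0 : 0 < s by exact: lt_le_trans s1.
exists s^-1; first by rewrite invr_gt0 s0 invf_le1.
move=> k Z ZZ rZ; have [w0|w0] := posnP (k * (n - k)).
  by rewrite w0 expr0 gram_int_det1.
have kn : (k <= n)%N by rewrite -{1}rZ rank_leq_row.
apply: (@le_trans _ _ s^-1).
  by rewrite ler_iXnr ?invr_ge0 ?invf_le1 ?(ltW s0).
rewrite -div1r ler_pdivrMr// (le_trans (gram_int_ge1 ZZ rZ))//.
rewrite -{1}[Z](mulKmx gu) (le_trans ((Hc k).2 _))// mulrC.
by rewrite ler_wpM2l ?gram_ge0// sumc.
Qed.

Lemma semistable_mulr n th (g A : 'M[R]_n) :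
  A \is a mxOver Num.int -> \det A = 1 -> semistable th g ->
  semistable th (g *m A).
Proof.
move=> AZ A1 gth k Z ZZ rZ; rewrite -mulmxA; apply: gth.
  by rewrite mxOverM.
by rewrite eqmxMfull// row_full_unit unitmxE A1 unitr1.
Qed.

Lemma destabilizing1 n th (g : 'M[R]_n) : \det g = 1 ->
  destabilizing th g (1%:M : 'M[R]_n).
Proof.
move=> g1; split; rewrite ?mxrank1 ?mxOver_scalar ?rpred0 ?rpred1//.
by rewrite subnn muln0 expr0 mulmx1 gram_square g1 expr1n.
Qed.

(* The Harder-Narasimhan argument: by submodularity two incomparable
   destabilizing sublattices would violate semistability at their
   intersection or at their sum. *)
Lemma destabilizing_chain n th (g : 'M[R]_n) k k'
    (Z : 'M[R]_(n, k)) (Z' : 'M[R]_(n, k')) :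
  0 < th < 1 -> semistable th g -> destabilizing th g Z ->
  destabilizing th g Z' -> (k <= k')%N -> exists X, Z = Z' *m X.
Proof.
move=> /andP[th0 th1] gth [ZZ rZ gZ] [ZZ' rZ' gZ'] kk'.
have [a [c [c' [A [C [C' [ACZ rAC [_ [X' AX']] [ack [X ZX] gAC]
  [ack' _ gAC']]]]]]]] := ex_adapted_basis ZZ ZZ' rZ rZ'.
(* If [c = 0], the span of [Z] is that of [A], inside that of [Z']. *)
have [c0|c_gt0] := posnP c.
  subst c; move: ZX; rewrite -[X]vsubmxK mul_row_col [C]thinmx0 mul0mx addr0.
  by move=> ->; exists (X' *m usubmx X); rewrite mulmxA -AX'.
(* [c' = 0] would give [k' = a < a + c = k]. *)
have [c'0|c'_gt0] := posnP c'; first by exfalso; lia.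
exfalso; have full u v w : A *m u + (C *m v + C' *m w) = 0 ->
    [/\ u = 0, v = 0 & w = 0 :> 'cV_c'].
  rewrite -!mul_row_col => /((mxrank_colP _).2 rAC)/eqP.
  by rewrite -col_mx0 => /eqP/eq_col_mx[->]; rewrite -col_mx0 => /eq_col_mx[-> ->].
have rA : \rank A = a.
  apply/mxrank_colP => u Au; have [] // := full u 0 0.
  by rewrite Au !mulmx0 !addr0.
have rAC1 : \rank (row_mx A C) = (a + c)%N.
  apply/mxrank_colP => u; rewrite -[u]vsubmxK mul_row_col => ACu.
  have [|-> -> _] := full (usubmx u) (dsubmx u) 0; last by rewrite col_mx0.
  by rewrite mulmx0 addr0.
have [AZ CZ] : A \is a mxOver Num.int /\ row_mx A C \is a mxOver Num.int.
  have AZ : A \is a mxOver Num.int.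
    by apply/mxOverP => i j; have := mxOverP ACZ i (lshift _ j); rewrite row_mxEl.
  split=> //; apply/mxOverP => i j; rewrite mxE; case: splitP => l _.
    exact: (mxOverP AZ).
  have := mxOverP ACZ i (rshift _ (lshift _ l)).
  by rewrite row_mxEr row_mxEl.
have th0w m : 0 < th ^+ m by rewrite exprn_gt0.
have gA : th ^+ (a * (n - a)) <= gram (g *m A) by exact: gth.
have gA0 : 0 < gram (g *m A) by exact: lt_le_trans gA.
have gE := gth _ _ ACZ rAC.
have gAC0 : 0 < gram (row_mx (g *m A) (g *m C)).
  by rewrite -mul_mx_row; apply: lt_le_trans (gth _ _ CZ rAC1).
have := gram_submodular (g *m C') gA0 gAC0; rewrite -!mul_mx_row.
apply/negP; rewrite -ltNge.
have bn : (a + (c + c') <= n)%N by rewrite -rAC rank_leq_row.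
apply: (@le_lt_trans _ _ (th ^+ (k * (n - k)) * th ^+ (k' * (n - k')))).
  by rewrite ler_pM ?gram_ge0// ?(le_trans (gAC _)) ?(le_trans (gAC' _)) ?gZ ?gZ'.
apply: (@lt_le_trans _ _
  (th ^+ ((a + (c + c')) * (n - (a + (c + c')))) * th ^+ (a * (n - a)))).
  (* Strict concavity: the two sums of exponents differ by [2 * c * c'], which is positive, and
     [th < 1]. *)
  rewrite -!exprD ltr_iXn2l// -ack -ack'.
  move: bn => /subnK; move: (n - _)%N => r <-.
  rewrite (_ : (r + (a + (c + c')) - a) = r + c + c')%N; last by lia.
  rewrite (_ : (r + (a + (c + c')) - (a + c)) = r + c')%N; last by lia.
  rewrite (_ : (r + (a + (c + c')) - (a + c')) = r + c)%N; last by lia.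
  by nia.
by rewrite ler_pM// ltW.
Qed.

(** The relative loss is bounded uniformly in [M], so one small step is safe for infinitely many
    sublattices at once. *)
Lemma gram_diag_exp_lower n k (M : 'M[R]_(n, k)) (t : 'rV[R]_n) :
  (1 - 2 * k%:R * \sum_j `|t 0 j|) * gram M <= gram (diag_exp t *m M).
Proof.
rewrite -(@ler_pM2l _ k`!%:R) ?ltr0n ?fact_gt0//.
rewrite mulrCA gram_diag_exp gramE mulr_sumr; apply: ler_sum => f _.
rewrite ler_wpM2r ?sqr_ge0// (le_trans _ (expR_ge1Dx _))// lerD2l.
rewrite -mulrA -mulrN ler_pM2l// lerNl -sumrN mulr_natl.
have -> (x : R) : x *+ k = \sum_(l < k) x by rewrite sumr_const card_ord.
apply: ler_sum => l _; rewrite (bigD1 (f l))//= ler_wpDr ?sumr_ge0//.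
by rewrite (le_trans (ler_norm _))// normrN.
Qed.

(** For [\det g = 1] and [0 < n], rank [n] always belongs; the bound is strict in all intermediate
    ranks exactly when only [ord_max] is left. *)
Definition destab_ranks n th (g : 'M[R]_n) : {set 'I_n.+1} :=
  [set k : 'I_n.+1 |
    `[< (0 < k)%N /\ exists Z : 'M[R]_(n, k), destabilizing th g Z >]].

Lemma destabilizing_gap n th (g : 'M[R]_n) : \det g = 1 ->
  exists2 d, 0 < d & forall k (Z : 'M[R]_(n, k)), Z \is a mxOver Num.int ->
    \rank Z = k -> th ^+ (k * (n - k)) < gram (g *m Z) ->
    th ^+ (k * (n - k)) + d <= gram (g *m Z).
Proof.
move=> g1; have gu : g \in unitmx by rewrite unitmxE g1 unitr1.
have /choice[d Hd] k : exists d, 0 < d /\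
    forall Z : 'M[R]_(n, k), Z \is a mxOver Num.int ->
    th ^+ (k * (n - k)) < gram (g *m Z) ->
    th ^+ (k * (n - k)) + d <= gram (g *m Z).
  by have [d d0 Hd] := gram_gap k (th ^+ (k * (n - k))) gu; exists d.
(* [s^-1] is at most each of the finitely many gaps [d k]. *)
pose s := \sum_(j < n.+1) (d j)^-1.
have sd k : (k <= n)%N -> (d k)^-1 <= s.
  rewrite -ltnS => kn; rewrite /s (bigD1 (Ordinal kn))//= lerDl.
  by apply: sumr_ge0 => j _; rewrite invr_ge0 ltW// (Hd j).1.
have s0 : 0 < s by apply: lt_le_trans (sd 0%N isT); rewrite invr_gt0 (Hd _).1.
exists s^-1; first by rewrite invr_gt0.
move=> k Z ZZ rZ gZ; apply: le_trans ((Hd k).2 _ ZZ gZ); rewrite lerD2l.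
rewrite -[leRHS]invrK lef_pV2 ?posrE ?invr_gt0 ?(Hd k).1//.
by rewrite sd// -rZ rank_leq_row.
Qed.

(** The slope of [x ^+ w] is at most [w] on [0, 1]. *)
Lemma exprD_le (x e : R) w : 0 <= x -> 0 <= e -> x + e <= 1 ->
  (x + e) ^+ w <= x ^+ w + w%:R * e.
Proof.
move=> x0 e0 xe1; elim: w => [|w IH]; first by rewrite !expr0 mul0r addr0.
rewrite !exprS (le_trans (ler_wpM2l _ IH)) ?addr_ge0//.
have w0 : 0 <= w%:R * e by rewrite mulr_ge0.
have xw0 : 0 <= x ^+ w by rewrite exprn_ge0.
have xw1 : x ^+ w <= 1 by rewrite exprn_ile1//; lra.
have -> : w.+1%:R * e = w%:R * e + e by rewrite -natr1 mulrDl mul1r.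
move: (x ^+ w) (w%:R * e) w0 xw0 xw1 => y z.
by nra.
Qed.

(** All intermediate inequalities are strict, with a uniform gap, which leaves room for a larger
    [th]. *)
Lemma semistable_improve n th (g : 'M[R]_n) : 0 < th < 1 -> \det g = 1 ->
  semistable th g -> destab_ranks th g \subset [set ord_max]%SET ->
  exists2 th', th < th' <= 1 & semistable th' g.
Proof.
move=> /andP[th0 th1] g1 gth /fintype.subsetP K0.
have [d d0 Hd] := destabilizing_gap th g1.
have nn0 : 0 < (n * n).+1%:R :> R by rewrite ltr0n.
(* The exponents [k * (n - k)] are at most [n * n], so raising [th] by [e] raises each bound by at
   most [d]. *)
pose e := Num.min (1 - th) (d / (n * n).+1%:R).
have e0 : 0 < e by rewrite lt_min subr_gt0 th1 divr_gt0.
have the : th + e <= 1 by rewrite -lerBrDl ge_min lexx.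
exists (th + e); first by rewrite ltrDl e0.
move=> k Z ZZ rZ; have [w0|w0] := posnP (k * (n - k)).
  by rewrite w0 expr0 gram_int_det1.
have kn : (k <= n)%N by rewrite -{1}rZ rank_leq_row.
apply: le_trans (exprD_le _ (ltW th0) (ltW e0) the) _.
apply: (@le_trans _ _ (th ^+ (k * (n - k)) + d)).
  rewrite lerD2l (@le_trans _ _ ((n * n).+1%:R * e))//.
    rewrite ler_wpM2r ?(ltW e0)// ler_nat ltnW// ltnS leq_mul//.
    exact: leq_subr.
  by rewrite mulrC -ler_pdivlMr// ge_min lexx orbT.
apply: Hd => //; rewrite lt_neqAle gth// andbT; apply/eqP => gZ.
have k1n : (k < n.+1)%N by [].
have : Ordinal k1n \in destab_ranks th g.
  rewrite inE; apply/asboolP; split; last by exists Z.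
  by move: w0; rewrite muln_gt0 => /andP[].
by move=> /K0; rewrite inE -val_eqE /= => /eqP kE; rewrite kE subnn muln0 in w0.
Qed.

(** Equality for one [g] forces [\det X ^+ 2 = 1], which gives equality for every [h]. *)
Lemma gram_same_span n k l (h g : 'M[R]_n) (Z : 'M[R]_(n, k))
    (Z' : 'M[R]_(n, l)) X :
  k = l -> Z = Z' *m X -> 0 < gram (g *m Z') ->
  gram (g *m Z) = gram (g *m Z') -> gram (h *m Z) = gram (h *m Z').
Proof.
move=> kl; subst l => ->; rewrite !mulmxA !gram_mulmx => gZ.
rewrite -[in RHS](mulr1 (gram (g *m Z'))) => /(mulfI (lt0r_neq0 gZ)) ->.
by rewrite mulr1.
Qed.

Lemma det_diag_exp n (t : 'rV[R]_n) :
  \sum_j t 0 j = 0 -> \det (diag_exp t) = 1.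
Proof.
move=> t0; rewrite det_diag (eq_bigr (fun j => expR (t 0 j))); last first.
  by move=> j _; rewrite mxE.
by rewrite -expR_sum t0 expR0.
Qed.

(** One destabilizing sublattice is chosen per rank; these form a flag. A short flow along its
    ascent direction raises one of them and lowers none, while the gap protects all other
    sublattices. *)
Lemma semistable_ascent n th (g : 'M[R]_n) : (0 < n)%N ->
  0 < th < 1 -> \det g = 1 -> semistable th g ->
  ~~ (destab_ranks th g \subset [set ord_max]%SET) ->
  exists t : 'rV[R]_n, [/\ \sum_j t 0 j = 0, semistable th (diag_exp t *m g) &
    destab_ranks th (diag_exp t *m g) \proper destab_ranks th g].
Proof.
move=> n0 th01 g1 gth; set K := destab_ranks th g => /subsetPn[k1 k1K k1n].
have gu : g \in unitmx by rewrite unitmxE g1 unitr1.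
have [th0 th1] := andP th01.
pose kk (i : 'I_#|K|) : nat := enum_val i.
have HK (i : 'I_#|K|) : (0 < kk i)%N /\ exists Z : 'M[R]_(n, kk i), destabilizing th g Z.
  by have := enum_valP i; rewrite inE => /asboolP.
pose Z i := projT1 (cid (HK i).2).
have HZ i : destabilizing th g (Z i) := projT2 (cid (HK i).2).
have maxK : ord_max \in K.
  by rewrite inE; apply/asboolP; split=> //; exists 1%:M; exact: destabilizing1.
pose i0 := enum_rank_in maxK ord_max; pose i1 := enum_rank_in maxK k1.
have ki0 : kk i0 = n by rewrite /kk /i0 enum_rankK_in.
have injkk : injective kk by move=> i j /val_inj/enum_val_inj.
have i10 : i1 != i0.
  apply: contra k1n => /eqP/(congr1 enum_val).
  by rewrite !enum_rankK_in// inE => ->.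
have rgZ i : \rank (g *m Z i) = kk i.
  by rewrite eqmxMfull ?row_full_unit//; case: (HZ i).
have [i j kij|t [t0 tge [i2 i20 tgt]]] :=
  @ex_ascent_direction R n #|K| kk (fun i => g *m Z i) i0 i1 ki0 i10 injkk
    (fun i => (HK i).1) rgZ.
  have [X ->] := destabilizing_chain th01 gth (HZ i) (HZ j) kij.
  by exists X; rewrite mulmxA.
have [d d0 Hd] := destabilizing_gap th g1.
pose T := \sum_j `|t 0 j|; have T0 : 0 <= T by apply: sumr_ge0.
(* Makes the relative loss [x] satisfy [x * (1 + d) <= d / 2], so a value at least [v + d], with
   [v <= 1], stays above [v]. [1 + T] keeps the denominator positive. *)
pose s := d / (1 + d) / (4 * n%:R * (1 + T)).
have n0R : 0 < n%:R :> R by rewrite ltr0n.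
have d1 : 0 < 1 + d by rewrite addr_gt0.
have T1 : 0 < 1 + T by rewrite ltr_wpDr.
have s0 : 0 < s by rewrite /s !divr_gt0// !mulr_gt0.
have sT0 : 0 <= s * T by exact: mulr_ge0 (ltW s0) T0.
have st0 : \sum_j (s *: t) 0 j = 0.
  by under eq_bigr do rewrite mxE; rewrite -mulr_sumr t0 mulr0.
pose D := diag_exp (s *: t).
have far k (Y : 'M[R]_(n, k)) : (k <= n)%N ->
    th ^+ (k * (n - k)) + d <= gram (g *m Y) ->
    th ^+ (k * (n - k)) < gram (D *m g *m Y).
  move=> kn gY; rewrite -mulmxA; apply: lt_le_trans (gram_diag_exp_lower _ _).
  have -> : \sum_j `|(s *: t) 0 j| = s * T.
    by rewrite mulr_sumr; apply: eq_bigr => j _; rewrite mxE normrM gtr0_norm.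
  have v0 : 0 <= th ^+ (k * (n - k)) by rewrite exprn_ge0// ltW.
  have v1 : th ^+ (k * (n - k)) <= 1 by rewrite exprn_ile1// ltW.
  have x0 : 0 <= 2 * k%:R * (s * T) by exact: mulr_ge0 (mulr_ge0 (ler0n _ 2) (ler0n _ _)) sT0.
  have xd : 2 * k%:R * (s * T) * (1 + d) <= d / 2.
    have kT : k%:R * T <= n%:R * (1 + T).
      by rewrite ler_pM ?ler_nat// lerDr.
    have -> : d / 2 = 2 * s * (1 + d) * (n%:R * (1 + T)).
      by rewrite /s; field; rewrite !gt_eqF.
    have -> : 2 * k%:R * (s * T) * (1 + d) = 2 * s * (1 + d) * (k%:R * T) by ring.
    by rewrite ler_pM2l// mulr_gt0// mulr_gt0.
  move: (th ^+ _) (2 * _ * _) v0 v1 x0 xd gY => v x v0 v1 x0 xd gY.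
  have x1 : x <= 1 by nra.
  have : (1 - x) * (v + d) <= (1 - x) * gram (g *m Y).
    by rewrite ler_wpM2l// subr_ge0.
  by nra.
(* A destabilizing sublattice of the same rank as [Z i] has the same span and covolume, so it moves
   exactly as [Z i] does. *)
have near k (Y : 'M[R]_(n, k)) : (0 < k)%N -> destabilizing th g Y ->
    exists i, kk i = k /\ gram (D *m g *m Y) = gram (D *m (g *m Z i)) /\
      gram (g *m Z i) = th ^+ (k * (n - k)).
  move=> k0 HY; have [YZ rY gY] := HY.
  have kn : (k < n.+1)%N by rewrite ltnS -rY rank_leq_row.
  have kK : Ordinal kn \in K by rewrite inE; apply/asboolP; split=> //; exists Y.
  exists (enum_rank_in kK (Ordinal kn)); set i := enum_rank_in _ _.
  have kki : kk i = k by rewrite /kk /i enum_rankK_in.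
  have gZi : gram (g *m Z i) = th ^+ (k * (n - k)).
    by rewrite -{1 2}kki; case: (HZ i).
  split=> //; split=> //; rewrite mulmxA.
  have [X YX] := destabilizing_chain th01 gth HY (HZ i) (eq_leq (esym kki)).
  by apply: (gram_same_span _ (esym kki) YX) (etrans gY (esym gZi));
     rewrite gZi exprn_gt0.
exists (s *: t); split=> //.
  move=> k Y YZ rY; have [w0|w0] := posnP (k * (n - k)).
    by rewrite w0 expr0 gram_int_det1// det_mulmx g1 det_diag_exp// mulr1.
  have kn : (k <= n)%N by rewrite -{1}rY rank_leq_row.
  have := gth k Y YZ rY; rewrite le_eqVlt => /orP[/eqP gY|gY]; last first.
    by apply/ltW/far => //; exact: Hd.
  have k0 : (0 < k)%N by move: w0; rewrite muln_gt0 => /andP[].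
  by have [|i [_ [-> <-]]] := near k Y k0; [split|exact: tge].
(* By [far] no new rank appears; by [near] the rank of [i2] disappears. *)
apply/fintype.properP; split.
  apply/fintype.subsetP => k; rewrite inE => /asboolP[k0 [Y [YZ rY DY]]].
  rewrite inE; apply/asboolP; split=> //; exists Y; split=> //; apply/esym/eqP.
  rewrite eq_le gth//= leNgt; apply/negP => gY.
  by have := far k Y (ltn_ord k) (Hd _ _ YZ rY gY); rewrite DY ltxx.
exists (enum_val i2); first exact: enum_valP.
rewrite inE; apply/asboolP => -[k0 [Y [YZ rY DY]]].
have := gth _ Y YZ rY; rewrite le_eqVlt => /orP[/eqP gY|gY]; last first.
  by have := far _ Y (ltn_ord (enum_val i2)) (Hd _ _ YZ rY gY); rewrite DY ltxx.
have [|i [ki [DYi gZi]]] := near _ Y k0; first by split.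
have ii2 : i = i2 by exact: injkk.
by have := tgt s s0; rewrite -ii2 gZi -DYi DY ltxx.
Qed.

End Semistability.

(** * Orbit closures among matrices and among lattices *)

Section OrbitClosure.
Context {R : realType}.

Lemma continuous_mx (T : topologicalType) m n (f : T -> 'M[R]_(m, n)) :
  (forall i j, continuous (fun x => f x i j)) -> continuous f.
Proof.
move=> fc x A [P MP PA].
have : \forall y \near x, forall ij : 'I_m * 'I_n, P ij.1 ij.2 (f y ij.1 ij.2).
  by apply: filter_forall => -[i j]; exact: fc (MP i j).
by apply: filterS => y Py; apply: PA => i j; exact: (Py (i, j)).
Qed.

Lemma continuous_sum (T : topologicalType) (I : Type) (r : seq I)
    (f : I -> T -> R) :
  (forall i, continuous (f i)) -> continuous (fun x => \sum_(i <- r) f i x).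
Proof.
move=> fc x; elim: r => [|i r IH].
  under eq_fun do rewrite big_nil; exact: cvg_cst.
under eq_fun do rewrite big_cons.
by apply: cvgD => //; exact: fc.
Qed.

Lemma continuous_prod (T : topologicalType) (I : Type) (r : seq I)
    (f : I -> T -> R) :
  (forall i, continuous (f i)) -> continuous (fun x => \prod_(i <- r) f i x).
Proof.
move=> fc x; elim: r => [|i r IH].
  under eq_fun do rewrite big_nil; exact: cvg_cst.
under eq_fun do rewrite big_cons.
by apply: cvgM => //; exact: fc.
Qed.

Lemma continuous_mulmx (T : topologicalType) m n p (f : T -> 'M[R]_(m, n))
    (g : T -> 'M[R]_(n, p)) :
  (forall i j, continuous (fun x => f x i j)) ->
  (forall i j, continuous (fun x => g x i j)) ->
  forall i j, continuous (fun x => (f x *m g x) i j).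
Proof.
move=> fc gc i j; under eq_fun do rewrite mxE.
by apply: continuous_sum => k x; apply: cvgM; [exact: fc|exact: gc].
Qed.

Lemma continuous_det (T : topologicalType) n (f : T -> 'M[R]_n) :
  (forall i j, continuous (fun x => f x i j)) ->
  continuous (fun x => \det (f x)).
Proof.
move=> fc; rewrite /determinant; apply: continuous_sum => s x.
by apply: cvgM; [exact: cvg_cst|apply: continuous_prod => i; exact: fc].
Qed.

Lemma continuous_mx_entry m n i j :
  continuous (fun M : 'M[R]_(m, n) => M i j).
Proof. exact: coord_continuous. Qed.

Lemma continuous_mulmxlr m n (A : 'M[R]_m) (B : 'M[R]_n) :
  continuous (fun M : 'M[R]_(m, n) => A *m M *m B).
Proof.
apply: continuous_mx; apply: continuous_mulmx => [|i j]; last exact: cst_continuous.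
apply: continuous_mulmx => [i j|]; first exact: cst_continuous.
exact: continuous_mx_entry.
Qed.

Lemma continuous_gram_mulmx n k (Z : 'M[R]_(n, k)) :
  continuous (fun M : 'M[R]_n => gram (M *m Z)).
Proof.
have H : forall i j, continuous (fun M : 'M[R]_n => (M *m Z) i j).
  apply: continuous_mulmx => [|i j]; last exact: cst_continuous.
  exact: continuous_mx_entry.
apply: continuous_det; apply: continuous_mulmx => // i j.
by under eq_fun do rewrite mxE; exact: H.
Qed.

Lemma bounded_mx_compact m n (C : R) :
  exists2 K : set 'M[R]_(m, n), compact K &
    forall M : 'M[R]_(m, n), (forall i j, `|M i j| <= C) -> K M.
Proof.
pose V := [set v : 'rV[R]_(m * n) | forall i, `[- C, C]%classic (v ord0 i)].
have vc : continuous (vec_mx : 'rV[R]_(m * n) -> 'M[R]_(m, n)).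
  apply: continuous_mx => i j.
  under eq_fun do rewrite -[vec_mx _ _ _]mxvecE vec_mxK.
  exact: continuous_mx_entry.
exists [set vec_mx v | v in V].
  apply: continuous_compact; first exact: continuous_subspaceT.
  apply: (@rV_compact _ _ (fun=> `[- C, C]%classic)) => i.
  exact: segment_compact.
move=> M MC; exists (mxvec M); last exact: mxvecK.
move=> i; rewrite /= in_itv /= -ler_norml.
by case/mxvec_indexP: i => i j; rewrite mxvecE.
Qed.

(** The preimage of the diagonal orbit among matrices. The factor [A] allows a change of basis of
    the lattice, and closures are taken where bounded sets are relatively compact. *)
Definition matrix_orbit n (g : 'M[R]_n) : set 'M[R]_n :=
  [set M | exists (t : 'rV[R]_n) (A : 'M[R]_n), [/\ \sum_j t 0 j = 0,
     A \is a mxOver Num.int, \det A = 1 & M = diag_exp t *m g *m A]].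

Lemma diag_expD n (s t : 'rV[R]_n) :
  diag_exp s *m diag_exp t = diag_exp (s + t).
Proof.
rewrite /diag_exp mulmx_diag; congr diag_mx.
by apply/rowP => j; rewrite !mxE expRD.
Qed.

(** The orbit is stable under the continuous map that sends [M] to [diag_exp t *m M *m A]. *)
Lemma closure_matrix_orbit n (g M : 'M[R]_n) (t : 'rV[R]_n) (A : 'M[R]_n) :
  \sum_j t 0 j = 0 -> A \is a mxOver Num.int -> \det A = 1 ->
  closure (matrix_orbit g) M ->
  closure (matrix_orbit g) (diag_exp t *m M *m A).
Proof.
move=> t0 AZ A1 gM B /(@continuous_mulmxlr _ _ (diag_exp t) A) /gM.
move=> [_ [[s [A' [s0 AZ' A1' ->]]] BM]].
exists (diag_exp t *m (diag_exp s *m g *m A') *m A); split=> //.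
exists (t + s), (A' *m A); split.
- by under eq_bigr do rewrite mxE; rewrite big_split/= t0 s0 addr0.
- by rewrite mxOverM.
- by rewrite det_mulmx A1' A1 mulr1.
- by rewrite -diag_expD !mulmxA.
Qed.

Lemma matrix_orbit_refl n (g : 'M[R]_n) : matrix_orbit g g.
Proof.
exists 0, 1%:M; split; rewrite ?mxOver_scalar ?rpred0 ?rpred1 ?det1//.
  by rewrite big1// => j _; rewrite mxE.
rewrite mulmx1 /diag_exp (_ : map_mx _ _ = const_mx 1).
  by rewrite diag_const_mx mul1mx.
by apply/rowP => j; rewrite !mxE expR0.
Qed.

(** A neighbourhood in the quotient pulls back to [SL R n], whose topology is induced, hence to an
    open set of matrices, which meets the orbit. *)
Lemma pi_closure_matrix_orbit n (x : lattice_space R n) (h : SL R n) :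
  closure (matrix_orbit (val (repr x))) (val h) ->
  closure (diag_orbit x) (\pi_(lattice_space R n)%qT h).
Proof.
move=> hx N /pi_continuous; rewrite nbhsE => -[B [[U oU <-] Uh] BN].
have [_ [[t [A [t0 AZ A1 ->]]] UM]] := hx U (open_nbhs_nbhs (conj oU Uh)).
have a1 : \det (diag_exp t) == 1 by rewrite det_diag_exp.
have A1' : \det A == 1 by rewrite A1.
pose a := MkSL a1; pose A' := MkSL A1'.
exists (\pi_(lattice_space R n)%qT (a * repr x * A')%g); split; last first.
  exact: BN.
exists a.
  split; first exact: diag_mx_is_diag.
  by move=> i; rewrite !mxE eqxx mulr1n expR_gt0.
apply/lattice_space_eqP; rewrite mulKg; exact: AZ.
Qed.

(** Pulled back by [h], a subgroup of the lattice is integral and has a basis [Z]; then [val h *m Z]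
    computes its covolume. *)
Lemma semistable1_stable n (h : SL R n) :
  semistable 1 (val h) -> stable (\pi_(lattice_space R n)%qT h).
Proof.
move=> hst L; rewrite lattice_of_pi => Lh sL _.
have [||k [Z [rZ ZE]]] := @ex_Zbasis R n
    [set z | z \is a mxOver Num.int /\ L (val h *m z)].
- split=> [|u v [uZ Lu] [vZ Lv]].
    by split; rewrite ?mulmx0 ?mxOver0 ?rpred0//; exact: sL.1.
  by split; [exact: mxOver_intB|rewrite mulmxBr; exact: sL.2].
- by move=> z [].
have ZZ : Z \is a mxOver Num.int.
  apply/mxOverP => i j; have := Zspan_col Z j.
  by rewrite -ZE => -[/mxOverP/(_ i 0)]; rewrite mxE.
have bL : Zbasis L (val h *m Z).
  split; first by rewrite eqmxMfull// row_full_unit SL_unit.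
  apply/seteqP; split=> v.
    move=> Lv; have [z zZ zv] := Lh _ Lv.
    have : [set z | z \is a mxOver Num.int /\ L (val h *m z)] z.
      by split=> //; rewrite zv.
    by rewrite ZE => -[w wZ wz]; exists w => //; rewrite -mulmxA wz.
  move=> [w wZ <-]; have : Zspan Z (Z *m w) by exists w.
  by rewrite -ZE -mulmxA => -[].
rewrite (covolE bL) -[leLHS]sqrtr1 ler_wsqrtr//.
by have := hst k Z ZZ rZ; rewrite expr1n.
Qed.

End OrbitClosure.

(** * Attaining the maximal [th] and showing that it equals 1 *)

Section MaximalSemistability.
Context {R : realType}.

Lemma cluster_closed (T : topologicalType) (u : nat -> T) (M : T) (E : set T) :
  cluster (u @ \oo) M -> closed E -> (\forall j \near \oo, E (u j)) -> E M.
Proof. by move=> uM cE uE; apply: cE => B MB; exact: uM uE MB. Qed.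

(** Along a maximizing sequence semistability excludes short vectors, so reduced representatives
    stay bounded and cluster. The conditions on the limit are closed. *)
Lemma ex_max_semistable n (g : 'M[R]_n.+1) : \det g = 1 ->
  exists th (M : 'M[R]_n.+1), [/\ 0 < th <= 1,
    closure (matrix_orbit g) M, \det M = 1, semistable th M &
    forall th' M', th < th' <= 1 -> closure (matrix_orbit g) M' ->
      \det M' = 1 -> ~ semistable th' M'].
Proof.
move=> g1; pose P th (M : 'M[R]_n.+1) := [/\ closure (matrix_orbit g) M,
  \det M = 1 & semistable th M].
pose S := [set th : R | 0 < th <= 1 /\ exists M, P th M].
have [th0 th01 gth0] := ex_semistable g1.
have Sth0 : S th0.
  split=> //; exists g; split=> //; exact/subset_closure/matrix_orbit_refl.
have supS : has_sup S by split; [exists th0|exists 1 => th [/andP[]]].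
have Sle th : S th -> th <= sup S by move=> ?; exact: sup_upper_bound.
have s0 : 0 < sup S by apply: lt_le_trans (Sle _ Sth0); case/andP: th01.
have s1 : sup S <= 1 by apply: sup_le_ub => [|th [/andP[]]//]; exists th0.
(* Tends to 0, while [sup S - e j] stays at least [sup S / 2], so that one bound on short vectors
   serves all [j]. *)
pose e j : R := Num.min (j.+1%:R^-1) (sup S / 2).
have e0 j : 0 < e j by rewrite lt_min invr_gt0 ltr0n divr_gt0.
(* In dimension [n.+1] the exponent for rank 1 is [1 * (n.+1 - 1) = n]. *)
have c0 : 0 < (sup S / 2) ^+ n by rewrite exprn_gt0// divr_gt0.
have [C HC] := ex_bounded_representative n c0.
have /choice[u Hu] (j : nat) : exists M, [/\ P (sup S - e j) M &
    forall i k, `|M i k| <= C].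
  have [th [th1 [M [gM M1 Mth]]] jth] := sup_adherent (e0 j) supS.
  have ej : e j <= sup S / 2 by rewrite ge_min lexx orbT.
  have [|A [AZ A1 AC]] := HC M M1.
    move=> z zZ rz; apply: le_trans (Mth _ z zZ rz).
    rewrite mul1n subSS subn0 lerXn2r ?nnegrE//; [|by case/andP: th1 => /ltW|].
      by rewrite divr_ge0// ltW.
    by lra.
  exists (M *m A); split=> //; split.
  - have := closure_matrix_orbit (t := 0) _ AZ A1 gM.
    rewrite (_ : diag_exp 0 = 1%:M) ?mul1mx.
      by apply; rewrite big1// => j' _; rewrite mxE.
    by rewrite /diag_exp -diag_const_mx; congr diag_mx; apply/rowP => i;
       rewrite !mxE expR0.
  - by rewrite det_mulmx M1 A1 mulr1.
  - move=> k Z ZZ rZ; apply: le_trans (semistable_mulr AZ A1 Mth ZZ rZ).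
    rewrite lerXn2r ?nnegrE ?(ltW jth)//; last by case/andP: th1 => /ltW.
    by rewrite subr_ge0; lra.
have [K cK KC] := bounded_mx_compact n.+1 n.+1 C.
have [|M [_ uM]] := cK (u @ \oo) _.
  by exists 0%N => // j _; apply: KC; case: (Hu j).
have uP j : P (sup S - e j) (u j) by case: (Hu j).
exists (sup S), M; split; first by rewrite s0.
- apply: (cluster_closed (E := closure (matrix_orbit g)) uM); first exact: closed_closure.
  by exists 0%N => // j _; case: (uP j).
- suff: [set N : 'M[R]_n.+1 | \det N = 1] M by [].
  apply: (cluster_closed uM).
    apply: (@closed_comp _ _ (fun M : 'M[R]_n.+1 => \det M) [set 1]).
      by move=> N _; apply: continuous_det; exact: continuous_mx_entry.
    exact: closed_eq.
  by exists 0%N => // j _; case: (uP j).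
- move=> k Z ZZ rZ; apply/ler_addgt0Pr => d d0; rewrite -lerBlDr.
  set w := (k * (n.+1 - k))%N.
  suff: [set N : 'M[R]_n.+1 | sup S ^+ w - d <= gram (N *m Z)] M by [].
  apply: (cluster_closed uM).
    apply: (@closed_comp _ _ (fun M : 'M[R]_n.+1 => gram (M *m Z))
      [set x | sup S ^+ w - d <= x]); last exact: closed_ge.
    by move=> N _; exact: continuous_gram_mulmx.
  have w0 : 0 < w.+1%:R :> R by rewrite ltr0n.
  have wd0 : 0 < w.+1%:R^-1 * d by rewrite mulr_gt0 ?invr_gt0.
  near=> j; have [_ _ uj] := uP j; apply: le_trans (uj k Z ZZ rZ).
  (* By [exprD_le], replacing [sup S] by [sup S - e j] costs at most [w * e j], which is below [d]
     for large [j]. *)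
  rewrite lerBlDr -/w -[X in X ^+ w](subrK (e j) (sup S)).
  have ej : e j <= sup S / 2 by rewrite ge_min lexx orbT.
  apply: le_trans (exprD_le w _ (ltW (e0 j)) _) _.
  + by rewrite subr_ge0; lra.
  + by rewrite subrK.
  rewrite lerD2l (@le_trans _ _ (w.+1%:R * e j))//.
    by rewrite ler_wpM2r ?(ltW (e0 j))// ler_nat.
  rewrite -ler_pdivlMl// ge_min; apply/orP; left; apply: ltW.
  near: j; exact: (near_infty_natSinv_lt (PosNum wd0)).
- move=> th' M' /andP[th'1 th'2] gM' M'1 Mth'.
  have : th' <= sup S.
    by apply: Sle; split; [rewrite th'2 (lt_trans s0)|exists M'].
  by rewrite leNgt th'1.
Unshelve. all: by end_near. Qed.

(** Induction on the number of destabilizing ranks at the maximal [th]: each ascent stays in the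
    orbit closure and removes a rank, until [semistable_improve] contradicts maximality. *)
Lemma ex_semistable1 n (g : 'M[R]_n.+1) : \det g = 1 ->
  exists M : 'M[R]_n.+1, [/\ closure (matrix_orbit g) M, \det M = 1 &
    semistable 1 M].
Proof.
move=> g1; have [th [M [/andP[th0]]]] := ex_max_semistable g1.
rewrite le_eqVlt => /predU1P[-> gM M1 Mth _|th1 gM M1 Mth thmax].
  by exists M.
exfalso; have [m] := ubnP #|destab_ranks th M|.
have th01 : 0 < th < 1 by rewrite th0.
elim: m => // m IH in M gM M1 Mth *; rewrite ltnS => Mm.
have [Mn|Mn] := boolP (destab_ranks th M \subset [set ord_max]%SET).
  have [th' th'1 Mth'] := semistable_improve th01 M1 Mth Mn.
  exact: thmax th'1 gM M1 Mth'.
have [//|t [t0 tMth tM]] := semistable_ascent _ th01 M1 Mth Mn.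
apply: (IH _ _ _ tMth); last exact: leq_trans (proper_card tM) Mm.
  have := closure_matrix_orbit (A := 1%:M) t0 _ _ gM.
  by rewrite mulmx1; apply; rewrite ?det1 ?mxOver_scalar ?rpred0 ?rpred1.
by rewrite det_mulmx det_diag_exp// M1 mulr1.
Qed.

End MaximalSemistability.

Theorem theorem1p1 (R : realType) (n : nat) (hn : (2 <= n)%N)
    (x : lattice_space R n) :
  exists2 y : lattice_space R n, closure (diag_orbit x) y & stable y.
Proof.
case: n hn x => // n _ x.
have [M [xM M1 Mst]] := ex_semistable1 (det_SL (repr x)).
have M1' : \det M == 1 by rewrite M1.
exists (\pi_(lattice_space R n.+1)%qT (MkSL M1')).
  exact: pi_closure_matrix_orbit.
exact: semistable1_stable.
Qed.
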